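(* Let $G$ be an outerplanar graph with maximum degree $\Delta(G)$. Then $\chi_{vi,2}(G)\leq \Delta(G)+3$.
   Context: All graphs are finite, simple and undirected. An incidence of $G$ is a pair $(v,e)$ with $v\in V(G)$, $e\in E(G)$, $v\in e$; $I(G)$ denotes the set of incidences. Let $G^{1/3}$ be the graph obtained from $G$ by replacing each edge $e=\{u,v\}$ by the path $u,(u,e),(v,e),v$, so $V(G^{1/3})=V(G)\cup I(G)$. A $vi$-simultaneous proper $k$-coloring of $G$ is a map $c:V(G)\cup I(G)\to\{1,\dots,k\}$ such that any two distinct elements at distance at most $3$ in $G^{1/3}$ receive distinct colors (equivalently, a proper vertex coloring of $G^{3/3}=(G^{1/3})^3$; this is exactly the condition that any two adjacent or incident elements of $V(G)\cup I(G)$ get distinct colors). For a vertex $v$, let $I_2(v)=\{(u,\{u,v\}) : u\in N_G(v)\}$ be the set of second incidences of $v$. A $vi$-simultaneous proper $k$-coloring is a $(k,s)$-coloring if for every vertex $v$ at most $s$ distinct colors appear on $I_2(v)$. $\chi_{vi,s}(G)$ is the smallest $k$ such that $G$ has a $vi$-simultaneous $(k,s)$-coloring. A graph is outerplanar if it has a planar drawing with all vertices on the outer face. *)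

(* Defs.v *)
From mathcomp Require Import all_boot all_order all_algebra.
From mathcomp Require Import all_classical all_reals all_analysis.

Set Implicit Arguments.
Unset Strict Implicit.
Unset Printing Implicit Defensive.

Import Order.TTheory GRing.Theory Num.Theory.
Import numFieldNormedType.Exports.

Record sgraph := SGraph {
  vertex :> finType;
  adj : rel vertex;
  adj_sym : symmetric adj;
  adj_irr : irreflexive adj }.

Definition nbhd (G : sgraph) (v : G) : {set G} := [set u : G | adj v u]%SET.

Definition max_degree (G : sgraph) : nat := \max_(v : G) #|nbhd v|.

Definition edges (G : sgraph) : {set {set G}} :=
  [set A : {set G} | [exists u : G, exists v : G,
                        adj u v && (A == [set u; v]%SET)]]%SET.

Definition incidence (G : sgraph) : Type :=
  {p : G * {set G} | (p.2 \in edges G) && (p.1 \in p.2)}.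

Definition third_adj (G : sgraph) : rel (G + incidence G) :=
  fun x y => match x, y with
  | inl _, inl _ => false
  | inl v, inr i => v == (val i).1
  | inr i, inl v => v == (val i).1
  | inr i, inr j => (i != j) && ((val i).2 == (val j).2)
  end.

Lemma third_adj_sym (G : sgraph) : symmetric (@third_adj G).
Proof. by move=> [v|i] [w|j] //=; rewrite eq_sym [in X in _ && X]eq_sym. Qed.

Lemma third_adj_irr (G : sgraph) : irreflexive (@third_adj G).
Proof. by move=> [v|i] //=; rewrite eqxx. Qed.

Definition third (G : sgraph) : sgraph :=
  SGraph (@third_adj_sym G) (@third_adj_irr G).

Definition dist_le (G : sgraph) (n : nat) (x y : G) : Prop :=
  exists p : seq G, [/\ path (@adj G) x p, last x p = y & (size p <= n)%N].

Definition vi_proper (G : sgraph) (k : nat) (c : third G -> 'I_k) : Prop :=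
  forall x y : third G, x <> y -> dist_le 3 x y -> c x <> c y.

Definition second_incidences (G : sgraph) (v : G) : {set incidence G} :=
  [set i : incidence G | [exists u : G,
     (u \in nbhd v) && (val i == (u, [set u; v]%SET))]]%SET.

Definition vi_coloring (G : sgraph) (k s : nat) (c : third G -> 'I_k) : Prop :=
  vi_proper c /\
  forall v : G, (#|[set c (inr i) | i in second_incidences v]%SET| <= s)%N.

Definition vi_colorable (G : sgraph) (s k : nat) : Prop :=
  exists c : third G -> 'I_k, vi_coloring s c.

(* Every graph is (k, s)-colorable for some k as soon as s > 0: use one private
   color for each vertex and another one for each set of second incidences. *)
Section Existence.
Variable G : sgraph.

Lemma edgesP (A : {set G}) :
  reflect (exists u v : G, adj u v /\ A = [set u; v]%SET) (A \in edges G).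
Proof.
rewrite inE; apply: (iffP existsP) => [[u /existsP[v /andP[uv /eqP->]]]|].
  by exists u, v.
by move=> [u [v [uv ->]]]; exists u; apply/existsP; exists v; rewrite uv eqxx.
Qed.

Lemma incidenceP (i : incidence G) :
  exists u v : G, adj u v /\ val i = (u, [set u; v]%SET).
Proof.
case: i => -[w A] /= /andP[/edgesP[u [v [uv ->]]]].
rewrite !inE => /orP[]/eqP->; first by exists u, v.
by exists v, u; rewrite adj_sym uv; split=> //; rewrite finset.setUC.
Qed.

Definition other_end (i : incidence G) : G :=
  odflt (val i).1 [pick v | v \in (val i).2 :\ (val i).1].

Lemma other_endE (i : incidence G) (u v : G) :
  adj u v -> val i = (u, [set u; v]%SET) -> other_end i = v.
Proof.
move=> uv ei; rewrite /other_end ei /=.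
have uDv : v != u by apply: contraTneq uv => ->; rewrite adj_irr.
case: pickP => [w|/(_ v)] /=; rewrite !inE ?eqxx ?uDv ?orbT //=.
by case: eqVneq => //= _ /eqP.
Qed.

Lemma other_end_proper (i j : incidence G) :
  i <> j -> dist_le 3 (inr i : third G) (inr j : third G) ->
  other_end i <> other_end j.
Proof.
move=> iDj [p [pth lst sz]] oij.
have [u [v [uv ei]]] := incidenceP i; have [w [v' [wv' ej]]] := incidenceP j.
move: oij; rewrite (other_endE uv ei) (other_endE wv' ej) => vv'; subst v'.
have uDv : (u == v) = false by apply: contraTF uv => /eqP->; rewrite adj_irr.
have wDv : (w == v) = false by apply: contraTF wv' => /eqP->; rewrite adj_irr.
have uDw : (u == w) = false.
  by apply/eqP => uw; apply: iDj; apply: val_inj; rewrite ei ej uw.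
have edgeF : ([set u; v]%SET == [set w; v]%SET) = false.
  by apply/eqP => /finset.setP/(_ u); rewrite !inE eqxx uDw uDv.
have memi (m : incidence G) : (val m).1 \in (val m).2 by case: m => m mP; case/andP: (mP).
case: p pth lst sz => [|x [|y [|z [|]]]] //=.
- by move=> _ [].
- by rewrite andbT => xi e; subst x; move: xi => /=; rewrite ei ej /= edgeF andbF.
- rewrite andbT => /andP[ix xj] e; subst y; move: ix xj.
  case: x => [a|m] /=; rewrite ei ej /=.
    by move=> /eqP->; rewrite uDw.
  by move=> /andP[_ /eqP<-]; rewrite edgeF andbF.
- rewrite andbT => /and3P[ix xy yj] e; subst z; move: ix xy yj.
  case: x => [a|m]; case: y => [b|m'] //=; rewrite ei ej /=.
  + move=> /eqP-> /eqP um' /andP[_ /eqP m'e].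
    by have := memi m'; rewrite -um' m'e !inE uDw uDv.
  + move=> /andP[_ /eqP me] /eqP bm /eqP bw.
    by have := memi m; rewrite -bm bw -me !inE eq_sym uDw wDv.
  + move=> /andP[_ /eqP me] /andP[_ /eqP mm'] /andP[_ /eqP m'j].
    by move: edgeF; rewrite me mm' m'j eqxx.
Qed.

Lemma vi_colorable_exists (s : nat) :
  (0 < s)%N -> exists k : nat, `[< vi_colorable G s k >].
Proof.
move=> s_gt0; exists #|{: G + G}|; apply/asboolP.
pose c (x : third G) : 'I_#|{: G + G}| := enum_rank
  (match x with inl v => inl v | inr i => inr (other_end i) end : G + G).
exists c; split=> [x y xDy dxy /enum_rank_inj|v].
  case: x y xDy dxy => [u|i] [v|j] //= xDy dxy [e]; first by case: xDy; rewrite e.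
  by apply: (other_end_proper _ dxy e) => ij; case: xDy; rewrite ij.
apply: leq_trans s_gt0; rewrite -(cards1 (enum_rank (inr v : G + G))).
apply/subset_leq_card/fintype.subsetP => a /imsetP[i i2 ->]; move: i2.
rewrite inE => /existsP[u /andP[]]; rewrite inE adj_sym => uv /eqP ei.
by rewrite inE /c (other_endE uv ei).
Qed.

End Existence.

Definition chi_vi (G : sgraph) (s : nat) (s_gt0 : (0 < s)%N) : nat :=
  ex_minn (vi_colorable_exists G s_gt0).

Section Drawings.
Local Open Scope classical_set_scope.
Local Open Scope ring_scope.
Variables (R : realType) (G : sgraph).

(* Only the values of [arc A] on [0, 1], for A an edge, are meaningful. *)
Definition planar_drawing (pt : G -> R * R) (arc : {set G} -> R -> R * R) :
    Prop :=
  [/\ injective pt,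
      (forall A, A \in edges G ->
         [/\ {within `[0, 1], continuous (arc A)},
             {in `[0, 1] &, injective (arc A)} &
             exists u v : G,
               [/\ A = [set u; v]%SET, arc A 0 = pt u & arc A 1 = pt v]]),
      (forall A (v : G), A \in edges G -> ~ (arc A @` `]0, 1[) (pt v)) &
      (forall A B, A \in edges G -> B \in edges G -> A <> B ->
         (arc A @` `]0, 1[) `&` (arc B @` `[0, 1]) = set0)].

Definition drawing_set (pt : G -> R * R) (arc : {set G} -> R -> R * R) :
    set (R * R) :=
  range pt `|` \bigcup_(A in [set A | A \in edges G]) (arc A @` `[0, 1]).

Definition face (D F : set (R * R)) : Prop :=
  exists2 x, (~` D) x & F = connected_component (~` D) x.

Definition outer_face (D F : set (R * R)) : Prop :=
  face D F /\ ~ bounded_set F.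

(* A face is disjoint from the drawing, so a vertex lies on its boundary iff it
   lies in its closure. *)
Definition outerplanar : Prop :=
  exists (pt : G -> R * R) (arc : {set G} -> R -> R * R),
    planar_drawing pt arc /\
    exists2 F, outer_face (drawing_set pt arc) F &
      forall v : G, closure F (pt v).

End Drawings.

(* Main.v *)
(* An outerplanar drawing extends to a drawing of G plus an apex placed in the outer
   face, in which disjoint edges stay at positive distance. Replacing the curves by
   generic polylines and counting crossings of disjoint edges modulo 2 excludes K5 and
   K33, hence G has neither a K4 nor a K23 minor. No accessibility of the vertices from
   the outer face and no Jordan curve theorem is needed, since only disjoint edges
   are compared.

   In a graph of minimum degree at least 2 without these minors, take a set K of
   vertices that is attached to the rest along a single edge z z', of minimum size: K is
   the interior of a chordless path from z to z'. So there is a vertex of degree 2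
   in a triangle, or two adjacent vertices of degree 2, or, for maximum degree 2, a
   cycle component. Deleting these vertices and extending a colouring of the rest
   proves the theorem by induction. At a vertex v of a coloured graph the colours of
   v, of the incidences at v and of the second incidences of v form three disjoint
   sets, the last of size at most 2, so that Delta + 3 colours leave one free. *)

Require Import Defs.
From mathcomp Require Import all_boot.
From mathcomp Require Import zify.

Set Implicit Arguments.
Unset Strict Implicit.
Unset Printing Implicit Defensive.

(** * Minors *)

(** The drawn curves are only known to be connected sets, with disjoint edges at positive distance;
    polylines are obtained from them as chains of short steps. Such polylines may meet themselves or
    those of edges with a common end, but crossings of disjoint edges vanish. Replacing each
    polyline by its chord changes the crossing parity of two disjoint edges by terms that see one
    edge and one end of the other: a coboundary in van Kampen's sense. So the straight drawing on
    the same nodes would have a coboundary as crossing parities. Summing over all pairs of disjoint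
    edges kills coboundaries, yet the sum is odd for K5, by a sign check on five points, and hence
    for K33.

    On the colouring side the tight case is Delta = 3: six colours may all be forbidden at a new
    vertex of a triangle, and an edge coloured earlier has to be recoloured. For Delta = 2 there are
    only five colours, while the extension steps at a triangle or at two adjacent vertices need six;
    so a cycle component is coloured all at once by a cyclic word. *)

Section Minors.
Variables (T : finType) (e : rel T).
Implicit Types (X Y : {set T}) (M : nat -> {set T}).

Definition induced X : rel T := [rel u v | [&& e u v, u \in X & v \in X]].

Definition connected_in X :=
  forall x y, x \in X -> y \in X -> connect (induced X) x y.

Definition touch X Y := exists x y, [/\ x \in X, y \in Y & e x y].

Definition branch_sets n M := forall i, (i < n) ->
  [/\ connected_in (M i), exists x, x \in M i &
      forall j, (j < n) -> i != j -> [disjoint M i & M j]].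

Definition K4_minor := exists2 M, branch_sets 4 M &
  forall i j, (i < j < 4) -> touch (M i) (M j).

Definition K23_minor := exists2 M, branch_sets 5 M &
  forall i j, (i < 2) -> (2 <= j < 5) -> touch (M i) (M j).

Hypothesis e_sym : symmetric e.

Lemma induced_sym X : connect_sym (induced X).
Proof.
by apply: sym_connect_sym => x y; rewrite /induced /= e_sym; congr (_ && _); exact: andbC.
Qed.

Lemma connect_induced_sub X Y : X \subset Y ->
  subrel (connect (induced X)) (connect (induced Y)).
Proof.
move=> /subsetP XY; apply: connect_sub => x y /and3P[xy xX yX].
by apply: connect1; rewrite /induced /= xy !XY.
Qed.

Lemma connected_inU X Y : connected_in X -> connected_in Y ->
  touch X Y -> connected_in (X :|: Y).
Proof.
move=> cX cY [x0 [y0 [x0X y0Y xy0]]].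
have root z : z \in X :|: Y -> connect (induced (X :|: Y)) x0 z.
  rewrite inE => /orP[zX|zY].
    by apply: connect_induced_sub (cX _ _ x0X zX); exact: subsetUl.
  apply: (@connect_trans _ _ y0); first by apply: connect1; rewrite /induced /= !inE xy0 x0X y0Y orbT.
  by apply: connect_induced_sub (cY _ _ y0Y zY); exact: subsetUr.
move=> x y xXY yXY; apply: connect_trans (root _ yXY).
by rewrite induced_sym root.
Qed.

End Minors.

Section MinorMono.
Variables (T : finType) (e e' : rel T).
Hypothesis ee' : subrel e e'.

Lemma touchS X Y : touch e X Y -> touch e' X Y.
Proof. by move=> [x [y [xX yY /ee' xy]]]; exists x, y. Qed.

Lemma branch_setsS n M : branch_sets e n M -> branch_sets e' n M.
Proof.
move=> eM i i_n; have [c ne d] := eM i i_n; split=> // x y xM yM.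
apply: connect_sub (c _ _ xM yM) => u v /and3P[/ee' uv uM vM].
by apply: connect1; rewrite /induced /= uv uM vM.
Qed.

Lemma K4_minorS : K4_minor e -> K4_minor e'.
Proof.
by move=> [M eM tM]; exists M; [exact: branch_setsS|move=> i j /tM/touchS].
Qed.

Lemma K23_minorS : K23_minor e -> K23_minor e'.
Proof.
move=> [M eM tM]; exists M; [exact: branch_setsS|move=> i j i2 j5].
exact/touchS/tM.
Qed.

End MinorMono.

(** * Graphs without K4 and K23 minors *)

Ltac slia :=
  repeat match goal with
  | H : ?P |- _ =>
    lazymatch type of P with
    | Prop =>
      lazymatch P with
      | is_true (leq _ _) => fail
      | is_true (andb (leq _ _) (leq _ _)) => fail
      | is_true (negb (leq _ _)) => fail
      | is_true (negb (andb _ _)) => fail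
      | is_true (negb (@eq_op _ _ _)) => fail
      | is_true (orb (leq _ _) (leq _ _)) => fail
      | @eq ?A _ _ => tryif unify A nat then fail else clear H
      | _ => clear H
      end
    end
  end; lia.

Lemma last_take (T : Type) (x : T) q j : j <= size q ->
  last x (take j q) = nth x (x :: q) j.
Proof. by elim: q x j => [|y q IH] x [|j] //= jq; rewrite IH // (set_nth_default y). Qed.

Section Ear.
Variables (T : finType) (e : rel T).
Hypotheses (e_sym : symmetric e) (e_irr : irreflexive e).
Implicit Types (K L X Y : {set T}) (x y z w : T).

Lemma edge_neq x y : e x y -> x != y.
Proof. by move=> xy; apply: contraTneq xy => ->; rewrite e_irr. Qed.

Lemma touchC X Y : touch e X Y -> touch e Y X.
Proof. by move=> [x [y [xX yY xy]]]; exists y, x; rewrite e_sym. Qed.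

Lemma branch_setsI n (M : nat -> {set T}) :
  (forall i, i < n -> connected_in e (M i)) ->
  (forall i, i < n -> exists x, x \in M i) ->
  (forall i j, i < j < n -> forall x, x \in M i -> x \in M j -> False) ->
  branch_sets e n M.
Proof.
move=> c ne d.
have d' i j : i < j < n -> [disjoint M i & M j].
  move=> ij; rewrite disjoint_subset; apply/subsetP => x xi.
  by rewrite !inE; apply/negP; exact: d xi.
move=> i i_n; split=> [||j j_n]; [exact: c|exact: ne|rewrite neq_ltn].
by move=> /orP[ij|ji]; [apply: d'; slia|rewrite disjoint_sym; apply: d'; slia].
Qed.

Lemma component_connected_in K w :
  connected_in e [set v | connect (induced e K) w v].
Proof.
set C := [set v | _].
have root v : connect (induced e K) w v -> connect (induced e C) w v.
  move=> /connectP[p + ->]; elim/last_ind: p => [|p v' IH] //.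
  rewrite rcons_path last_rcons => /andP[wp pv]; apply: connect_trans (IH wp) _.
  have cp : connect (induced e K) w (last w p) by apply/connectP; exists p.
  apply: connect1; have /and3P[ev _ _] := pv.
  rewrite /induced /= ev !inE cp /=; apply: connect_trans cp _; exact: connect1.
move=> x y; rewrite !inE => /root wx /root wy.
by apply: connect_trans wy; rewrite induced_sym.
Qed.

(** * A cycle and a connected set attached to it *)

Section Segments.
Variables (s : nat) (y : nat -> T).
Hypothesis y_inj : forall i j, i <= s.+1 -> j <= s.+1 -> y i = y j -> i = j.
Hypothesis y_edge : forall i, i <= s -> e (y i) (y i.+1).

Definition seg i j : {set T} := [set y k | k : 'I_s.+2 & i <= k <= j].

Lemma segP i j x : j <= s.+1 ->
  reflect (exists2 k, i <= k <= j & x = y k) (x \in seg i j).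
Proof.
move=> js; apply: (iffP imsetP) => [[k]|[k ikj ->]].
  by rewrite inE => ikj ->; exists k.
have ks : k < s.+2 by slia.
by exists (Ordinal ks); rewrite ?inE.
Qed.

Lemma mem_seg i j k : j <= s.+1 -> k <= s.+1 -> (y k \in seg i j) = (i <= k <= j).
Proof.
move=> js ks; apply/segP/idP => // [[l ilj /y_inj ->] //|]; last by exists k.
by slia.
Qed.

Lemma seg_connected i j : j <= s.+1 -> connected_in e (seg i j).
Proof.
move=> js.
have root k : i <= k <= j -> connect (induced e (seg i j)) (y i) (y k).
  elim: k => [|k IH] ikj; first by have -> : i = 0 by slia.
  have [->|ik] := eqVneq i k.+1; first exact: connect0.
  apply: connect_trans (IH _) _; first slia.
  apply: connect1; rewrite /induced /= y_edge ?mem_seg //; slia.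
move=> _ _ /(segP _ _ js)[k ikj ->] /(segP _ _ js)[l ilj ->].
by apply: connect_trans (root l ilj); rewrite induced_sym // root.
Qed.

Lemma set1_connected x : connected_in e [set x].
Proof. by move=> u v; rewrite !inE => /eqP-> /eqP->. Qed.

Variable L : {set T}.
Hypothesis L_conn : connected_in e L.
Hypothesis L_mem : exists x, x \in L.
Hypothesis L_off : forall i, i <= s.+1 -> y i \notin L.
Hypothesis ends : e (y 0) (y s.+1).

Definition attached i := exists2 x, x \in L & e x (y i).

Lemma attached_touch i j k : i <= k <= j -> j <= s.+1 -> attached k ->
  touch e (seg i j) L.
Proof.
move=> ikj js [x xL xk]; exists (y k), x; split; rewrite ?mem_seg // 1?e_sym //.
by slia.
Qed.

(** Two attachments that are not consecutive split the cycle into two arcs. The side of size two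
    consists of a stretch ending at [y p] and one starting at [y q]; the side of size three of [L],
    the vertices strictly between [p] and [q], and one vertex [y c] of the other arc. *)
Lemma ear_K23 p q : p.+1 < q -> q <= s.+1 -> ~~ ((p == 0) && (q == s.+1)) ->
  attached p -> attached q -> K23_minor e.
Proof.
move=> pq qs pq' ap aq.
(* The other arc runs through the closing edge from [s.+1] to [0]. For [p = 0] it has an inner
   vertex [c = s.+1], since then [q <= s]; otherwise [c = 0] serves. The rest of this arc joins the
   stretches at [p] and [q]. *)
have [a [b [c [ap' qb bs [cs cab] [ta tb]]]]] : exists a b c,
    [/\ a <= p, q <= b, b <= s.+1, c <= s.+1 /\ ~~ (a <= c <= b)
      & touch e (seg a p) [set y c] /\ touch e (seg q b) [set y c]].
  case: p pq pq' ap => [|p] pq pq' ap.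
    exists 0, s, s.+1; split; [slia|slia|slia|split; slia|split].
      by exists (y 0), (y s.+1); rewrite mem_seg ?inE ?eqxx.
    exists (y s), (y s.+1); rewrite mem_seg ?inE ?eqxx //.
    by split=> //; [slia|exact: y_edge].
  exists 1, s.+1, 0; split; [slia|slia|slia|split; slia|split].
    exists (y 1), (y 0); rewrite mem_seg ?inE ?eqxx //; last slia.
    by split=> //; rewrite e_sym; exact: y_edge.
  by exists (y s.+1), (y 0); rewrite mem_seg ?inE ?eqxx // e_sym; split=> //; slia.
pose M := nth set0 [:: seg a p; seg q b; [set y c]; seg p.+1 q.-1; L].
have inL i j x : j <= s.+1 -> x \in seg i j -> x \in L -> False.
  move=> js /(segP _ _ js)[k ikj ->]; apply/negP/L_off; slia.
have dis i j i' j' x : j <= s.+1 -> j' <= s.+1 -> (j < i') || (j' < i) ->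
    x \in seg i j -> x \in seg i' j' -> False.
  move=> js js' jj' /(segP _ _ js)[k ikj ->]; rewrite mem_seg //; slia.
exists M.
  apply: branch_setsI => [i|i|i j].
  - case: i => [|[|[|[|[|i]]]]] // _; rewrite /M /=.
    + by apply: seg_connected; slia.
    + by apply: seg_connected; slia.
    + exact: set1_connected.
    + by apply: seg_connected; slia.
  - case: i => [|[|[|[|[|i]]]]] // _; rewrite /M /=.
    + by exists (y p); rewrite mem_seg; slia.
    + by exists (y q); rewrite mem_seg; slia.
    + by exists (y c); rewrite inE.
    + by exists (y p.+1); rewrite mem_seg; slia.
  - case: i => [|[|[|[|[|i]]]]]; case: j => [|[|[|[|[|j]]]]] // _;
      rewrite /M /= => x; try (by apply: inL; slia); try (by apply: dis; slia).
    + by move=> xs /set1P xc; move: xs; rewrite xc mem_seg; slia.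
    + by move=> xs /set1P xc; move: xs; rewrite xc mem_seg; slia.
    + by move=> /set1P ->; rewrite mem_seg; slia.
    + by move=> /set1P ->; apply/negP; exact: L_off.
    + by rewrite nth_nil inE.
have tseg k i j i' j' : i <= k <= j -> i' <= k.+1 <= j' -> j <= s.+1 ->
    j' <= s.+1 -> k <= s -> touch e (seg i j) (seg i' j').
  move=> ikj ikj' js js' ks; exists (y k), (y k.+1).
  by rewrite !mem_seg ?y_edge //; slia.
case=> [|[|i]] // j; case: j => [|[|[|[|[|j]]]]] // _ _; rewrite /M /=.
- by apply: (tseg p); slia.
- by apply: (@attached_touch _ _ p) => //; slia.
- by apply: touchC; apply: (tseg q.-1); slia.
- by apply: (@attached_touch _ _ q) => //; slia.
Qed.

Lemma ear_K4 : s = 1 -> attached 0 -> attached 1 -> attached 2 -> K4_minor e.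
Proof.
move=> s1 a0 a1 a2.
pose M := nth L [:: [set y 0]; [set y 1]; [set y 2]].
have d i j : i < j <= 2 -> y i != y j.
  by move=> ij; apply/eqP => /y_inj; slia.
have a i : i <= 2 -> attached i by case: i => [|[|[|]]].
exists M.
  apply: branch_setsI => [i|i|i j].
  - by case: i => [|[|[|[|i]]]] // _; rewrite /M /=; try exact: set1_connected.
  - case: i => [|[|[|[|i]]]] // _; rewrite /M /=.
    + by exists (y 0); rewrite inE.
    + by exists (y 1); rewrite inE.
    + by exists (y 2); rewrite inE.
  - move=> ij x; have [j3|j3] := ltnP j 3.
      have -> : M i = [set y i] by case: i ij => [|[|[|i]]] //; slia.
      have -> : M j = [set y j] by case: j j3 ij => [|[|[|j]]].
      by move=> /set1P -> /set1P; apply/eqP/d; slia.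
    have -> : M j = L by rewrite /M nth_default.
    have -> : M i = [set y i] by case: i ij => [|[|[|i]]] //; slia.
    by move=> /set1P ->; apply/negP/L_off; slia.
move=> i j ij; have -> : M i = [set y i] by case: i ij => [|[|[|i]]] //; slia.
have [j3|j3] := ltnP j 3; last first.
  have -> : M j = L by rewrite /M nth_default.
  have [|x xL xi] := a i; first slia.
  by exists (y i), x; rewrite inE eqxx e_sym.
have -> : M j = [set y j] by case: j j3 ij => [|[|[|j]]].
exists (y i), (y j); rewrite !inE !eqxx; split=> //.
move: i j ij j3 => [|[|i]] [|[|[|j]]] //= _ _; try exact: y_edge; last first.
  by apply: y_edge; rewrite s1.
by move: ends; rewrite s1.
Qed.

End Segments.

(** * Lobes and ears *)

Variable U : {set T}.
Hypothesis e_U : forall x y, e x y -> y \in U.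
Hypothesis deg2 : forall x, x \in U -> 1 < #|[set y | e x y]|.
Hypothesis noK4 : ~ K4_minor e.
Hypothesis noK23 : ~ K23_minor e.

(** A chordless cycle closed by the edge from [y 0] to [y s.+1], where only these two ends may have
    neighbours off the cycle. *)
Definition ear s (y : nat -> T) :=
  [/\ 0 < s, forall i j, i <= s.+1 -> j <= s.+1 -> y i = y j -> i = j,
      forall i, i <= s -> e (y i) (y i.+1), e (y 0) (y s.+1) &
      forall i x, 0 < i <= s -> e (y i) x -> x = y i.-1 \/ x = y i.+1].

Lemma other_nbr x a : x \in U -> exists2 b, e x b & b != a.
Proof.
move=> xU; have /set0Pn[b] : [set y | e x y] :\ a != set0.
  rewrite -card_gt0 -subn_gt0; have := deg2 xU.
  by rewrite (cardsD1 a); case: (a \in _); slia.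
by rewrite !inE => /andP[ba xb]; exists b.
Qed.

(** Connectedness of [K] is not part of the definition, so that the induction can start from all of
    [U] except the ends of one edge. *)
Definition lobe z z' K := [/\ e z z', z \notin K, z' \notin K,
  exists w, w \in K & (forall x, x \in K -> x \in U) /\
  forall x y, x \in K -> e x y -> [|| y \in K, y == z | y == z']].

Lemma lobeC z z' K : lobe z z' K -> lobe z' z K.
Proof.
move=> [zz' zK z'K Kw [KU KN]]; split=> //; first by rewrite e_sym.
by split=> // x y xK xy; rewrite [X in _ || X]orbC; exact: KN xy.
Qed.

(** If [K] hangs on [z'] alone, a neighbour [y] of [z'] in [K] is taken out and the edge [z' y]
    takes over. If [K] hangs on neither end, an edge inside [K] takes over. Degree at least two
    keeps the remaining set nonempty. *)
Lemma lobe_shrink z z' K : lobe z z' K -> (forall x, x \in K -> ~~ e z x) ->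
  exists a a' (K' : {set T}), lobe a a' K' /\ #|K'| < #|K|.
Proof.
move=> [zz' zK z'K [w wK] [KU KN]] zN.
have KN' x y : x \in K -> e x y -> (y \in K) || (y == z').
  move=> xK xy; have /or3P[->//|/eqP yz|->] := KN _ _ xK xy; last by rewrite orbT.
  by have := zN _ xK; rewrite -yz e_sym xy.
have [y /andP[yK z'y]|no] := pickP [pred y | (y \in K) && e z' y].
  exists z', y, (K :\ y); split; last by rewrite [X in _ < X](cardsD1 y) yK.
  have [b yb bz'] := other_nbr z' (KU _ yK).
  split; rewrite ?inE ?eqxx ?negb_and ?z'K ?orbT //.
    exists b; rewrite !inE eq_sym (edge_neq yb).
    by have := KN' _ _ yK yb; rewrite (negPf bz') orbF.
  split=> [x|x v]; first by rewrite !inE => /andP[_ /KU].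
  rewrite !inE => /andP[_ xK] /(KN' _ _ xK).
  by case: (v == y); case: (v == z'); case: (v \in K).
have KN2 x y : x \in K -> e x y -> y \in K.
  move=> xK xy; have := KN' _ _ xK xy => /orP[//|/eqP yz'].
  by have := no x; rewrite /= xK -yz' e_sym xy.
have [b wb _] := other_nbr w (KU _ wK).
have bK := KN2 _ _ wK wb.
have [c wc cb] := other_nbr b (KU _ wK).
exists w, b, (K :\ w :\ b); split; last first.
  rewrite [X in _ < X](cardsD1 w) wK [X in _ < _ + X](cardsD1 b).
  by rewrite !inE bK eq_sym (edge_neq wb); slia.
split; rewrite ?inE ?eqxx ?andbF //.
  by exists c; rewrite !inE cb eq_sym (edge_neq wc) (KN2 _ _ wK wc).
split=> [x|x v]; first by rewrite !inE => /and3P[_ _ /KU].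
rewrite !inE => /and3P[_ _ xK] /(KN2 _ _ xK) ->.
by case: (v == b); case: (v == w).
Qed.

(* A shortest path joining the ends of [z z'] through [K] is chordless. *)
Lemma lobe_path z z' K : lobe z z' K -> connected_in e K ->
  (exists2 x, x \in K & e z x) -> (exists2 x, x \in K & e z' x) ->
  exists s (y : nat -> T), [/\ 0 < s, y 0 = z & y s.+1 = z'] /\
   [/\ forall i, 0 < i <= s -> y i \in K,
    forall i, i <= s -> e (y i) (y i.+1) &
    forall i j, i.+1 < j -> j <= s.+1 -> ~~ ((i == 0) && (j == s.+1)) ->
      ~~ e (y i) (y j)].
Proof.
move=> [zz' zK z'K _ [KU KN]] cK [k1 k1K zk1] [k2 k2K z'k2].
pose good ys := [&& 0 < size ys, all (mem K) ys & path e z (rcons ys z')].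
have [n0 n0P] : exists n, [exists ys : n.-tuple T, good ys].
  have /connectP[p pP lp] := cK _ _ k1K k2K.
  exists (size p).+1; apply/existsP; exists (in_tuple (k1 :: p)) => /=.
  rewrite /good /= k1K zk1 /= rcons_path -lp e_sym z'k2 andbT.
  have -> : all (mem K) p.
    elim: p k1 {k1K zk1 lp} pP => [|x p IH] k //= /andP[/and3P[_ _ xK] /IH->].
    by rewrite xK.
  by apply: sub_path pP => u v /and3P[].
have nE : exists n, [exists ys : n.-tuple T, good ys] by exists n0.
case: (ex_minnP nE) => s /existsP[ys ysP] smin.
have sys : size ys = s by rewrite size_tuple.
have min ys' : good ys' -> s <= size ys'.
  by move=> g; apply: smin; apply/existsP; exists (in_tuple ys').
case/and3P: ysP => s0 aK pz; rewrite sys in s0.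
pose q := rcons ys z'; pose y i := nth z (z :: q) i.
have sq : size q = s.+1 by rewrite size_rcons sys.
have yK i : 0 < i <= s -> y i \in K.
  case: i => [|i] // /andP[_ i_s]; rewrite /y /= nth_rcons sys i_s.
  by apply: (allP aK); rewrite mem_nth // sys.
have ye i : i <= s -> e (y i) (y i.+1).
  by move=> i_s; rewrite /y /=; apply: (pathP z pz); rewrite sq ltnS.
exists s, y; split; first by rewrite /y /= nth_rcons sys ltnn eqxx.
split=> //.
move=> i j ij js nij; apply/negP => eij.
(* As [y i] is entry [i.-1] of [ys], the chord leaves [y 1 .. y i] and [y j .. y s]. The excluded
   pair [0], [s.+1] is the edge [z z'] itself, whose shortcut would be empty. *)
suff : good (take i ys ++ drop j.-1 ys).
  by move/min; rewrite size_cat size_take size_drop sys; case: ifP; slia.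
apply/and3P; split.
- by rewrite size_cat size_take size_drop sys; case: ifP; move: nij; slia.
- rewrite all_cat; apply/andP; split.
    by apply/allP => x /mem_take/(allP aK).
  by apply/allP => x /mem_drop/(allP aK).
have dE : rcons (drop j.-1 ys) z' = drop j.-1 q.
  by rewrite /q drop_rcons // sys; slia.
have tE : take i ys = take i q.
  by rewrite /q -cats1 takel_cat // sys; slia.
rewrite rcons_cat dE tE cat_path.
have pq k : k <= s.+1 -> path e z (take k q) && path e (y k) (drop k q).
  move=> ks; rewrite /y -last_take ?sq // -cat_path cat_take_drop.
  exact: pz.
have [|-> _ /=] := andP (pq i _); first slia.
rewrite last_take ?sq -/(y i); last slia.
have -> : drop j.-1 q = y j :: drop j q.
  have j0 : 0 < j by slia.
  by rewrite -[in RHS](prednK j0) /y /= -(drop_nth z) // sq; slia.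
by rewrite /= eij; have /andP[] := pq j js.
Qed.

Lemma lobe_ear z z' K : lobe z z' K -> exists s (y : nat -> T), ear s y.
Proof.
have [n] := ubnP #|K|; elim: n z z' K => // n IH z z' K Kn lK.
have {IH}IH a a' K' : #|K'| < #|K| -> lobe a a' K' -> exists s (y : nat -> T), ear s y.
  by move=> K'K; apply: IH; slia.
have IHs : (exists a a' (K' : {set T}), lobe a a' K' /\ #|K'| < #|K|) ->
    exists s (y : nat -> T), ear s y.
  by move=> [a [a' [K' [lK' K'K]]]]; apply: IH lK'.
have [x /andP[xK zx]|no] := pickP [pred x | (x \in K) && e z x]; last first.
  apply: IHs; apply: lobe_shrink lK _ => x xK.
  by have := no x; rewrite /= xK /= => ->.
have [x' /andP[x'K zx']|no] := pickP [pred x | (x \in K) && e z' x]; last first.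
  apply: IHs; apply: (lobe_shrink (lobeC lK)) => y yK.
  by have := no y; rewrite /= yK /= => ->.
have [zz' zK z'K _ [KU KN]] := lK.
(* A component that differs from [K] is a smaller lobe on the same edge. *)
have [cK|ncK] := boolP [forall w in K, K == [set v | connect (induced e K) w v]];
  last first.
  move: ncK; rewrite negb_forall_in => /exists_inP[w wK].
  set C := [set v | _] => KC.
  have CK : C \subset K.
    apply/subsetP => v; rewrite inE => /connectP[p + ->].
    elim/last_ind: p => [|p u _] //; rewrite rcons_path last_rcons.
    by move=> /andP[_ /and3P[]].
  apply: (IH z z' C); first by apply: proper_card; rewrite properEneq eq_sym KC.
  split=> //; [exact: contra (subsetP CK _) zK|exact: contra (subsetP CK _) z'K| |].
    by exists w; rewrite inE connect0.
  split=> [v /(subsetP CK)/KU //|u v uC uv].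
  have uK := subsetP CK _ uC.
  have /orP[vK|->] := KN _ _ uK uv; last by rewrite orbT.
  rewrite inE; apply/orP; left; move: uC; rewrite inE => wu.
  by apply: connect_trans wu (connect1 _); rewrite /induced /= uv uK vK.
have {}cK : connected_in e K.
  by move=> u v uK vK; have /forall_inP/(_ _ uK)/eqP Ku := cK; move: vK; rewrite {1}Ku inE.
have [s [y [[s0 y0 ys1] [yK ye ych]]]] := lobe_path lK cK
  (ex_intro2 (fun v => v \in K) (fun v => e z v) x xK zx)
  (ex_intro2 (fun v => v \in K) (fun v => e z' v) x' x'K zx').
have yends : e (y 0) (y s.+1) by rewrite y0 ys1.
have y_inj i j : i <= s.+1 -> j <= s.+1 -> y i = y j -> i = j.
  wlog ij : i j / i < j => [W|] is_ js yij.
    by case: (ltngtP i j) => // ij; [|symmetry]; apply: W.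
  exfalso; case: i ij is_ yij => [|i] ij is_ yij.
    have [j1|js1] := eqVneq j s.+1.
      by have := edge_neq zz'; rewrite -y0 -ys1 -j1 yij eqxx.
    by move: zK; rewrite -y0 yij yK //; slia.
  have [j1|js1] := eqVneq j s.+1.
    by move: z'K; rewrite -ys1 -j1 -yij yK //; slia.
  have /negP := ych i j ltac:(slia) js ltac:(slia); apply.
  by rewrite -yij; apply: ye; slia.
have nbr i j : 0 < i <= s -> j <= s.+1 -> e (y i) (y j) -> j = i.-1 \/ j = i.+1.
  move=> is_ js eij; have ij : i != j by apply: contraTneq eij => ->; rewrite e_irr.
  case: (ltngtP i j) ij => // ij _.
    right; case: (ltngtP j i.+1) => //; first slia.
    by move=> ij'; have := ych i j ij' js ltac:(slia); rewrite eij.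
  left; case: (ltngtP j.+1 i) => [ij'||]; [|slia|slia].
  by have := ych j i ij' ltac:(slia) ltac:(slia); rewrite e_sym eij.
have [KP|] := boolP (K \subset seg s y 1 s).
  exists s, y; split=> // i x1 is_ ex.
  have [j js xj] : exists2 j, j <= s.+1 & x1 = y j.
    have /or3P[xK1|/eqP->|/eqP->] := KN _ _ (yK _ is_) ex.
    - have /segP[|j j1s ->] := subsetP KP _ xK1; first slia.
      by exists j => //; slia.
    - by exists 0.
    - by exists s.+1.
  by move: ex; rewrite xj => /(nbr _ _ is_ js)[]->; [left|right].
(* [L] is a component of [K] off the path, so all its attachments are on the cycle. If they lie on a
   single edge of the cycle, [L] is a smaller lobe; otherwise a forbidden minor appears. *)
move=> /subsetPn[w wK wS]; pose K' := K :\: seg s y 1 s.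
pose L := [set v | connect (induced e K') w v].
have wK' : w \in K' by rewrite inE wS.
have LK' : L \subset K'.
  apply/subsetP => v; rewrite inE => /connectP[p + ->].
  elim/last_ind: p => [|p u _] //; rewrite rcons_path last_rcons.
  by move=> /andP[_ /and3P[]].
have LK v : v \in L -> v \in K by move=> /(subsetP LK'); rewrite inE => /andP[].
have L_off i : i <= s.+1 -> y i \notin L.
  move=> is_; apply/negP => yL; have := subsetP LK' _ yL; rewrite inE mem_seg //.
  case: (boolP (0 < i <= s)) => //= ni.
  have [->|i0] := eqVneq i 0; first by rewrite y0 (negPf zK).
  have -> : i = s.+1 by slia.
  by rewrite ys1 (negPf z'K).
have L_mem : exists v, v \in L by exists w; rewrite inE connect0.
have L_conn : connected_in e L by exact: component_connected_in.
have L_lt : #|L| < #|K|.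
  apply: proper_card; apply/properP; split; first exact/subsetP.
  by exists (y 1); [apply: yK; slia|apply: L_off].
have LN u v : u \in L -> e u v -> v \in L \/ exists2 j, j <= s.+1 & v = y j.
  move=> uL uv; have /or3P[vK|/eqP->|/eqP->] := KN _ _ (LK _ uL) uv.
  - have [vS|vS] := boolP (v \in seg s y 1 s).
      move: vS => /segP[|j js ->]; first slia.
      by right; exists j => //; slia.
    left; rewrite inE; have := uL; rewrite inE => wu; apply: connect_trans wu _.
    by apply: connect1; rewrite /induced /= uv (subsetP LK' _ uL) inE vS vK.
  - by right; exists 0.
  - by right; exists s.+1.
pose att i := [exists u in L, e u (y i)].
have attP i : reflect (attached y L i) (att i) by apply: exists_inP.
have lobe_L a b : a <= s.+1 -> b <= s.+1 -> e (y a) (y b) ->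
    (forall j, j <= s.+1 -> att j -> (j == a) || (j == b)) ->
    exists s (y : nat -> T), ear s y.
  move=> as_ bs eab ab; apply: (IH (y a) (y b) L) => //; split=> //; try exact: L_off.
  split=> [v /LK/KU //|u v uL uv]; have [->//|[j js vj]] := LN _ _ uL uv.
  have /orP[/eqP <-|/eqP <-] : (j == a) || (j == b).
  - by apply: ab => //; apply/exists_inP; exists u => //; rewrite -vj.
  - by rewrite vj eqxx orbT.
  - by rewrite vj eqxx !orbT.
have K23 p q : p.+1 < q -> q <= s.+1 -> ~~ ((p == 0) && (q == s.+1)) ->
    att p -> att q -> exists s (y : nat -> T), ear s y.
  move=> pq qs npq /attP ap /attP aq; case: noK23.
  exact: (ear_K23 y_inj ye L_conn L_mem L_off yends pq qs npq ap aq).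
have [[p ps1] ap|noatt] := pickP [pred i : 'I_s.+2 | att i]; last first.
  apply: (lobe_L 0 s.+1) => // j js aj.
  by have := noatt (Ordinal (js : j < s.+2)); rewrite /= aj.
(* From here on [p] and [q] are the least and the greatest attachment. *)
case: (@arg_minnP _ (Ordinal ps1) [pred i : 'I_s.+2 | att i] val ap) => {p ps1 ap}.
move=> [p ps] /= ap pmin.
case: (@arg_maxnP _ (Ordinal ps) [pred i : 'I_s.+2 | att i] val ap).
move=> [q qs] /= aq qmax.
have between j : j <= s.+1 -> att j -> p <= j <= q.
  move=> js aj; have := pmin (Ordinal (js : j < s.+2)) aj.
  by have /= := qmax (Ordinal (js : j < s.+2)) aj; rewrite /= => -> ->.
have [pq|pq] := leqP q p.+1.
  have [pq1|ps2] := eqVneq p s.+1.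
    apply: (lobe_L s s.+1) => //; [exact: ye|].
    by move=> j js aj; have := between _ js aj; slia.
  apply: (lobe_L p p.+1) => //; [slia|by apply: ye; slia|].
  by move=> j js aj; have := between _ js aj; slia.
have [/andP[/eqP p0 /eqP qs1]|npq] := boolP ((p == 0) && (q == s.+1)); last first.
  by apply: (K23 p q).
subst p q.
(* Both ends of the closing edge are attached. An inner attachment [j] is not consecutive to one of
   them, unless [s = 1]: then the cycle is a triangle attached at all three corners, which gives
   K4. *)
have [[j js] /andP[/= aj j1s]|nomid] := pickP [pred i : 'I_s.+2 | att i & 0 < i <= s];
  last first.
  apply: (lobe_L 0 s.+1) => // j js aj.
  by have := nomid (Ordinal (js : j < s.+2)); rewrite /= aj /=; slia.
have [j1|j1] := leqP j 1; last by apply: (K23 0 j) => //; slia.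
have {j1}j1 : j = 1 by slia.
subst j; have [s1|s1] := leqP s 1; last by apply: (K23 1 s.+1) => //; slia.
have {}s1 : s = 1 by slia.
case: noK4; apply: (ear_K4 y_inj ye L_conn L_mem L_off yends s1).
- exact/attP.
- exact/attP.
- by apply/attP; rewrite -s1.
Qed.

Lemma ear_exists : (exists x, x \in U) -> exists s (y : nat -> T), ear s y.
Proof.
move=> [x xU]; have [z xz _] := other_nbr x xU.
have [w xw wz] := other_nbr z xU.
apply: (@lobe_ear x z (U :\ x :\ z)); split; rewrite ?inE ?eqxx ?andbF //.
  by exists w; rewrite !inE wz eq_sym (edge_neq xw) (e_U xw).
split=> [v|u v]; first by rewrite !inE => /and3P[].
by move=> _ /e_U vU; rewrite !inE vU; case: (v == z); case: (v == x).
Qed.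

End Ear.

(** * Extending colourings *)

Definition word m j := if j < 4 * m then j %% 4 else (j - 4 * m) %% 5.

Lemma word_lt m j : word m j < 5.
Proof. by rewrite /word; case: ifP; lia. Qed.

(* The cyclic word (0123)^m (01234)^b has no repetition at distance at most 3. *)
Lemma word_cyclic m b N j k : N = 4 * m + 5 * b -> 3 < N -> j < N -> k < N ->
  (j < k <= j + 3) || (k < j) && (k + N <= j + 3) -> word m j != word m k.
Proof. by rewrite /word; case: ifP; case: ifP; lia. Qed.

Section Colouring.
Variables (T : finType) (e : rel T) (C : finType).
Hypotheses (e_sym : symmetric e) (e_irr : irreflexive e).
Implicit Types (U : {set T}) (x y z u v w : T) (c : T -> C) (a : T -> T -> C).

Definition nb U x : {set T} := [set y in U | e x y].
Definition outs U a x : {set C} := [set a x y | y in nb U x].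
Definition ins U a x : {set C} := [set a y x | y in nb U x].

(* [a x y] is the colour of the incidence of [x] with the edge [x y]. *)
Definition ok U c a x :=
  [/\ forall y, y \in nb U x -> [/\ c y != c x, a x y != c x & a y x != c x],
      {in nb U x &, injective (a x)},
      forall y z, y \in nb U x -> z \in nb U x -> a x y != a z x
    & #|ins U a x| <= 2].

Definition good U c a := forall x, x \in U -> ok U c a x.

Lemma nbE U x y : (y \in nb U x) = (y \in U) && e x y.
Proof. by rewrite inE. Qed.

Lemma avoid (s : seq C) : size s < #|C| -> exists g, g \notin s.
Proof.
move=> sC; have [g gs|no] := pickP [pred g | g \notin s]; first by exists g.
suff : #|C| <= size s by lia.
apply: leq_trans (card_size s).
apply: subset_leq_card; apply/subsetP => g _.
by have := no g; rewrite /= => /negbFE.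
Qed.

Lemma ok_eq U U' c c' a a' x : nb U' x = nb U x -> c' x = c x ->
  (forall y, y \in nb U x -> [/\ c' y = c y, a' x y = a x y & a' y x = a y x]) ->
  ok U c a x -> ok U' c' a' x.
Proof.
move=> nE cx ag [h1 h2 h3 h4]; split; rewrite ?nE.
- move=> y yn; have [-> -> ->] := ag _ yn; rewrite cx; exact: h1.
- move=> y z yn zn; have [_ -> _] := ag _ yn; have [_ -> _] := ag _ zn.
  exact: h2.
- move=> y z yn zn; have [_ -> _] := ag _ yn; have [_ _ ->] := ag _ zn.
  exact: h3.
- by rewrite /ins nE (eq_in_imset (g := a^~ x)) // => y /ag[].
Qed.

(** Colours still possible for the incidence of [x] with a new edge at [x]. *)
Definition free U c a x : {set C} := ~: (c x |: (outs U a x :|: ins U a x)).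

(* [f] and [g] are the colours of the two incidences of a new edge at [x]: [f] at [x],
   [g] at the other end. *)
Definition admits U c a x f g :=
  [/\ g != c x, g \notin outs U a x, g != f & #|g |: ins U a x| <= 2].

Definition extc v (g : C) c x := if x == v then g else c x.
Definition exta v (f g : T -> C) a x y :=
  if y == v then f x else if x == v then g y else a x y.

(** The incidence of [x] with the edge [x v] gets [f x], that of [v] gets [g x]. Values of [f] may
    coincide, because two second incidences of [v] are not in conflict with each other; only their
    number of colours is bounded. *)
Lemma extend U c a v (f g : T -> C) (h : C) : v \notin U -> good U c a ->
  (forall x, x \in nb U v -> [/\ c x != h, f x \in free U c a x,
     admits U c a x (f x) (g x), h != f x & h != g x]) ->
  {in nb U v &, injective g} ->
  (forall x y, x \in nb U v -> y \in nb U v -> g x != f y) ->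
  #|[set f x | x in nb U v]| <= 2 ->
  good (v |: U) (extc v h c) (exta v f g a).
Proof.
move=> vU gU H g_inj gf f2 x; rewrite in_setU1.
have neU y : y \in U -> (y == v) = false.
  by move=> yU; apply: contraNF vU => /eqP <-.
have nbv : nb (v |: U) v = nb U v.
  by apply/setP => y; rewrite !inE; case: eqVneq => //= ->; rewrite e_irr andbF.
case: eqVneq => [-> _|xv /= xU].
  have agr y : y \in nb U v -> [/\ extc v h c y = c y,
      exta v f g a v y = g y & exta v f g a y v = f y].
    by rewrite nbE => /andP[/neU yv _]; rewrite /extc /exta yv !eqxx.
  have ch : extc v h c v = h by rewrite /extc eqxx.
  split; rewrite ?nbv ?ch.
  - by move=> y yn; have [-> -> ->] := agr _ yn; have [? _ _ ? ?] := H _ yn;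
      split=> //; rewrite eq_sym.
  - move=> y z yn zn; have [_ -> _] := agr _ yn; have [_ -> _] := agr _ zn.
    exact: g_inj.
  - move=> y z yn zn; have [_ -> _] := agr _ yn; have [_ _ ->] := agr _ zn.
    exact: gf.
  - by rewrite /ins nbv (eq_in_imset (g := f)) // => y /agr[].
have agr y : y \in nb U x -> [/\ extc v h c y = c y,
    exta v f g a x y = a x y & exta v f g a y x = a y x].
  by rewrite nbE => /andP[/neU yv _]; rewrite /extc /exta yv (neU _ xU).
have cx : extc v h c x = c x by rewrite /extc (neU _ xU).
have [xv_e|nxv] := boolP (e v x); last first.
  apply: (ok_eq _ cx agr) (gU _ xU); apply/setP => y; rewrite !inE.
  by case: eqVneq => //= ->; rewrite e_sym (negPf nxv) andbF.
have xn : x \in nb U v by rewrite nbE xU.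
have nbx : nb (v |: U) x = v |: nb U x.
  by apply/setP => y; rewrite !inE; case: eqVneq => //= ->; rewrite e_sym.
have [ch fx [gc gout gf' g2] hf hg] := H _ xn.
have [h1 h2 h3 h4] := gU _ xU.
have axv : exta v f g a x v = f x by rewrite /exta eqxx.
have avx : exta v f g a v x = g x by rewrite /exta eqxx (neU _ xU).
move: fx; rewrite !inE !negb_or => /and3P[fc fout fin].
have notout y : y \in nb U x -> a x y \in outs U a x by move=> yn; exact: imset_f.
have notin y : y \in nb U x -> a y x \in ins U a x by move=> yn; exact: (imset_f (a^~ x)).
split; rewrite ?nbx.
- move=> y /setU1P[->|yn]; last by have [-> -> ->] := agr _ yn; rewrite cx; exact: h1.
  by rewrite cx axv avx /extc eqxx eq_sym.
- move=> y z /setU1P[->|yn] /setU1P[->|zn] //.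
  + have [_ -> _] := agr _ zn; rewrite axv => fz.
    by move: fout; rewrite fz notout.
  + have [_ -> _] := agr _ yn; rewrite axv => fz.
    by move: fout; rewrite -fz notout.
  + have [_ -> _] := agr _ yn; have [_ -> _] := agr _ zn; exact: h2.
- move=> y z /setU1P[->|yn] /setU1P[->|zn].
  + by rewrite axv avx eq_sym.
  + have [_ _ ->] := agr _ zn; rewrite axv.
    by apply: contraNneq fin => ->; exact: notin.
  + have [_ -> _] := agr _ yn; rewrite avx.
    by apply: contraNneq gout => <-; exact: notout.
  + by have [_ -> _] := agr _ yn; have [_ _ ->] := agr _ zn; exact: h3.
- apply: leq_trans g2; apply: subset_leq_card; apply/subsetP => b.
  move=> /imsetP[y]; rewrite nbx => /setU1P[->|yn] ->.
    by rewrite avx setU11.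
  by have [_ _ ->] := agr _ yn; rewrite setU1r ?notin.
Qed.

Lemma extend_away U c a v f g (h : C) x : v \notin U -> x \in U -> ~~ e v x ->
  [/\ outs (v |: U) (exta v f g a) x = outs U a x,
      ins (v |: U) (exta v f g a) x = ins U a x
    & extc v h c x = c x].
Proof.
move=> vU xU vx.
have neU y : y \in U -> (y == v) = false.
  by move=> yU; apply: contraNF vU => /eqP <-.
have nE : nb (v |: U) x = nb U x.
  apply/setP => y; rewrite !inE.
  by case: eqVneq => //= ->; rewrite e_sym (negPf vx) andbF.
rewrite /outs /ins nE /extc (neU _ xU); split=> //.
  apply: eq_in_imset => y; rewrite nbE => /andP[/neU yv _].
  by rewrite /exta yv (neU _ xU).
apply: eq_in_imset => y; rewrite nbE => /andP[/neU yv _].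
by rewrite /exta yv (neU _ xU).
Qed.

Variable D : nat.
Hypothesis cardC : #|C| = D + 3.
Hypothesis deg_le : forall x, #|[set y | e x y]| <= D.

Lemma nb_lt U x v : v \notin U -> e v x -> #|nb U x| < D.
Proof.
move=> vU vx; apply: leq_trans (deg_le x).
suff : #|v |: nb U x| <= #|[set y | e x y]|.
  by rewrite cardsU1 nbE (negPf vU).
apply: subset_leq_card; apply/subsetP => y /setU1P[->|].
  by rewrite inE e_sym.
by rewrite !inE => /andP[].
Qed.

Lemma card_outs U a x : #|outs U a x| <= #|nb U x|.
Proof. exact: leq_imset_card. Qed.

(** Of the [D + 3] colours, one is lost to [c x], at most [D - 1] to [outs], the others to [ins]. *)
Lemma card_free U c a x : #|nb U x| < D -> 2 < #|free U c a x| + #|ins U a x|.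
Proof.
move=> xD; set S := outs U a x :|: ins U a x.
have E1 := cardsC (c x |: S); have E2 := cardsU1 (c x) S.
have E3 := (leq_card_setU (outs U a x) (ins U a x)).1.
have E4 := card_outs U a x; move: E1; rewrite cardC -/(free U c a x) => E1.
by move: E1 E2 E3 E4 xD; rewrite -/S; case: (_ \notin _) => /=; clear; lia.
Qed.

Lemma free_ex U c a x : #|nb U x| < D -> #|ins U a x| <= 2 ->
  exists f, f \in free U c a x.
Proof.
move=> /(card_free c a) h i2; have /set0Pn[f fP] : free U c a x != set0.
  by rewrite -card_gt0; lia.
by exists f.
Qed.

(** If [ins] has two colours, one of them differs from [b] and can be reused without increasing
    their number. If it has at most one, any colour other than [c x], [f], [b] and those of [outs]
    is allowed, which excludes at most [D + 2] colours. *)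
Lemma admits_ex U c a x f (b : C) : #|nb U x| < D -> ok U c a x ->
  f \in free U c a x -> exists2 g, admits U c a x f g & g != b.
Proof.
move=> xD [h1 h2 h3 h4]; rewrite !inE !negb_or => /and3P[fc fout fin].
have [i2|i1] := ltnP 1 #|ins U a x|.
  have /set0Pn[g] : ins U a x :\ b != set0.
    by rewrite -card_gt0; move: i2; rewrite (cardsD1 b); case: (_ \in _); clear; lia.
  rewrite !inE => /andP[gb gi]; exists g => //; split.
  - by move: gi => /imsetP[y yn ->]; have [_ _ ->] := h1 _ yn.
  - apply/negP => /imsetP[y yn gy]; move: gi => /imsetP[z zn gz].
    by have := h3 _ _ yn zn; rewrite -gy -gz eqxx.
  - by apply: contraNneq fin => <-.
  - by have /setUidPr -> : [set g] \subset ins U a x by rewrite sub1set.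
have /avoid[g] : size [:: c x, f, b & enum (outs U a x)] < #|C|.
  rewrite /= -cardE cardC; have := card_outs U a x; move: xD; clear; lia.
rewrite !inE mem_enum !negb_or => /and4P[gc gf gb gout]; exists g => //.
by split=> //; rewrite cardsU1; move: i1; case: (_ \notin _) => /=; clear; lia.
Qed.

Lemma admits_in U c a x f g : ok U c a x -> f \in free U c a x ->
  g \in ins U a x -> admits U c a x f g.
Proof.
move=> [h1 h2 h3 h4]; rewrite !inE !negb_or => /and3P[fc fout fin] gi; split.
- by move: gi => /imsetP[y yn ->]; have [_ _ ->] := h1 _ yn.
- apply/negP => /imsetP[y yn gy]; move: gi => /imsetP[z zn gz].
  by have := h3 _ _ yn zn; rewrite -gy -gz eqxx.
- by apply: contraNneq fin => <-.
- by have /setUidPr -> : [set g] \subset ins U a x by rewrite sub1set.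
Qed.

(** * Reducible configurations *)

Definition colourable U := exists c a, good U c a.

Lemma extend_pendant U v : v \notin U -> #|nb U v| <= 1 -> colourable U ->
  colourable (v |: U).
Proof.
move=> vU v1 [c [a gU]].
have [E|[x xn]] := set_0Vmem (nb U v).
  have [h _] : exists h : C, h \notin [::] by apply: avoid; rewrite cardC addn3.
  exists (extc v h c), (exta v (fun=> h) (fun=> h) a).
  by apply: extend; rewrite // E ?imset0 ?cards0 // => ?; rewrite inE.
have nE : nb U v = [set x].
  by apply/eqP; rewrite eq_sym eqEcard sub1set xn cards1.
have [xU vx] : x \in U /\ e v x by apply/andP; rewrite -nbE.
have xD := nb_lt vU vx.
have x2 : #|ins U a x| <= 2 by case: (gU _ xU).
have [f fP] := free_ex c xD x2.
have [g gP _] := admits_ex f xD (gU _ xU) fP.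
have [h] : exists h, h \notin [:: c x; f; g] by apply: avoid; rewrite cardC /=; lia.
rewrite !inE !negb_or => /and3P[hc hf hg].
exists (extc v h c), (exta v (fun=> f) (fun=> g) a); apply: extend => //.
- by move=> y; rewrite nE => /set1P ->; rewrite eq_sym.
- by move=> y z; rewrite nE => /set1P -> /set1P ->.
- by move=> _ _ _ _; case: gP.
- by rewrite nE imset_set1 cards1.
Qed.

Lemma extend_two U c a v x y al be gx gy h : v \notin U -> good U c a ->
  nb U v = [set x; y] -> x != y ->
  al \in free U c a x -> be \in free U c a y ->
  admits U c a x al gx -> admits U c a y be gy ->
  gx != gy -> gx != be -> gy != al ->
  h \notin [:: c x; c y; al; be; gx; gy] -> colourable (v |: U).
Proof.
move=> vU gU nE xy fa fb ax ay gxy gxb gya.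
rewrite !inE !negb_or => /and5P[h1 h2 h3 h4 /andP[h5 h6]].
pose f z := if z == x then al else be; pose g z := if z == x then gx else gy.
have yx : (y == x) = false by rewrite eq_sym (negPf xy).
exists (extc v h c), (exta v f g a); apply: extend => //; rewrite ?nE.
- by move=> z /set2P[]->; rewrite /f /g ?eqxx ?yx; split=> //; rewrite eq_sym.
- move=> z w /set2P[]-> /set2P[]->; rewrite /g ?eqxx ?yx //.
    by move=> E; rewrite E eqxx in gxy.
  by move=> E; rewrite E eqxx in gxy.
- move=> z w /set2P[]-> /set2P[]->; rewrite /f /g ?eqxx ?yx //.
    by case: ax.
  by case: ay.
- by apply: leq_trans (leq_imset_card _ _) _; rewrite cards2 xy.
Qed.

Lemma avoid_dup (s : seq C) : size s <= #|C| -> ~~ uniq s -> exists g, g \notin s.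
Proof.
move=> sC nu; have [|g] := @avoid (undup s); last by rewrite mem_undup; exists g.
by apply: leq_trans sC; rewrite ltn_size_undup.
Qed.

Lemma mem_outs U a x y : y \in nb U x -> a x y \in outs U a x.
Proof. by move=> yn; exact: imset_f. Qed.

Lemma mem_ins U a x y : y \in nb U x -> a y x \in ins U a x.
Proof. by move=> yn; exact: (imset_f (a^~ x)). Qed.

Lemma freeP U c a x f : f \in free U c a x ->
  [/\ f != c x, f \notin outs U a x & f \notin ins U a x].
Proof. by rewrite !inE !negb_or => /and3P[]. Qed.

(** The way out of the tight case of [extend_triangle]: the edge [x y] is recoloured so that both
    second incidences of [x] have the colour [be]. *)
Lemma recolour_ok U c a a' x y z (al be : C) : ok U c a x ->
  nb U x = [set y; z] -> y != z -> al \in free U c a x -> a z x = be ->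
  a' x y = al -> a' y x = be -> a' x z = a x z -> a' z x = be ->
  ok U c a' x.
Proof.
move=> [h1 h2 h3 h4] nE yz /freeP[alc alout alin] azx a1 a2 a3 a4.
have yn : y \in nb U x by rewrite nE set21.
have zn : z \in nb U x by rewrite nE set22.
have [cy _ _] := h1 _ yn; have [cz axz _] := h1 _ zn.
have bec : be != c x by rewrite -azx; have [] := h1 _ zn.
have bein : be \in ins U a x by rewrite -azx mem_ins.
have al_be : al != be by apply: contraNneq alin => ->.
have al_xz : al != a x z by apply: contraNneq alout => ->; rewrite mem_outs.
have xz_be : a x z != be by rewrite -azx; exact: h3.
split; rewrite ?nE.
- by move=> w /set2P[]->; rewrite ?a1 ?a2 ?a3 ?a4.
- move=> w w' /set2P[]-> /set2P[]->; rewrite ?a1 ?a3 // => E.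
    by rewrite E eqxx in al_xz.
  by rewrite E eqxx in al_xz.
- by move=> w w' /set2P[]-> /set2P[]->; rewrite ?a1 ?a2 ?a3 ?a4.
- apply: (@leq_trans #|[set be]|); last by rewrite cards1.
  apply: subset_leq_card; apply/subsetP => b /imsetP[w].
  by rewrite nE => /set2P[]-> ->; rewrite ?a2 ?a4 inE.
Qed.

Lemma nb_pair U x y z : y \in nb U x -> z \in nb U x -> y != z ->
  #|nb U x| <= 2 -> nb U x = [set y; z].
Proof.
move=> yn zn yz n2; apply/eqP; rewrite eq_sym eqEcard cards2 yz n2 andbT.
by apply/subsetP => w /set2P[]->.
Qed.

(** The incidences at [v] reuse the colours [a y x] and [a x y] of the edge [x y], which already are
    second-incidence colours at [x] and [y]. Only the colour of [v] is then at stake. It has to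
    avoid six colours, and this fails only if [D = 3] and the six are distinct and exhaust all
    colours; each alternative choice produces a repetition among them. *)
Lemma extend_triangle U v x y : 2 < D -> v \notin U -> nb U v = [set x; y] ->
  e x y -> colourable U -> colourable (v |: U).
Proof.
move=> D3 vU nE exy [c [a gU]].
have C6 : 6 <= #|C| by rewrite cardC; move: D3; clear; lia.
have xy : x != y by exact: edge_neq exy.
have [xU vx] : x \in U /\ e v x by apply/andP; rewrite -nbE nE set21.
have [yU vy] : y \in U /\ e v y by apply/andP; rewrite -nbE nE set22.
have xD := nb_lt vU vx; have yD := nb_lt vU vy.
have ynx : y \in nb U x by rewrite nbE yU exy.
have xny : x \in nb U y by rewrite nbE xU e_sym exy.
have try a' al be gx gy : good U c a' -> al \in free U c a' x ->
    be \in free U c a' y -> gx \in ins U a' x -> gy \in ins U a' y ->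
    gx != gy -> gx != be -> gy != al ->
    (exists h, h \notin [:: c x; c y; al; be; gx; gy]) -> colourable (v |: U).
  move=> gU' fa fb gxi gyi gxy gxb gya [h hP].
  apply: (extend_two vU gU' nE xy fa fb _ _ gxy gxb gya hP).
    exact: admits_in (gU' _ xU) fa gxi.
  exact: admits_in (gU' _ yU) fb gyi.
have pq a' : good U c a' -> [/\ a' y x \in ins U a' x, a' x y \in ins U a' y,
    a' y x != a' x y, forall be, be \in free U c a' y -> a' y x != be
    & forall al, al \in free U c a' x -> a' x y != al].
  move=> gU'; split; [exact: mem_ins|exact: mem_ins| | |].
  - by have [_ _ + _] := gU' _ yU; apply.
  - by move=> be /freeP[_ + _]; apply: contraNneq => <-; exact: mem_outs.
  - by move=> al /freeP[_ + _]; apply: contraNneq => <-; exact: mem_outs.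
have common a' al : good U c a' -> al \in free U c a' x ->
    al \in free U c a' y -> colourable (v |: U).
  move=> gU' fx fy; have [i1 i2 n1 n2 n3] := pq _ gU'.
  apply: (try a' al al (a' y x) (a' x y)) => //; [exact: n2|exact: n3|].
  by apply: avoid_dup => //; rewrite /= !inE !negb_or eqxx /= ?andbF.
have [okx1 okx2 okx3 okx4] := gU _ xU; have [oky1 oky2 oky3 oky4] := gU _ yU.
have [al fa] := free_ex c xD okx4; have [be fb] := free_ex c yD oky4.
have [i1 i2 n1 n2 n3] := pq _ gU.
set p := a y x in i1 n1 n2; set q := a x y in i2 n1 n3.
have [h hP|all6] := pickP [pred h | h \notin [:: c x; c y; al; be; p; q]].
  by apply: (try a al be p q) => //; [exact: n2|exact: n3|exists h].
have {}all6 h : h \in [:: c x; c y; al; be; p; q] by have := all6 h => /negbFE.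
have [u6|] := boolP (uniq [:: c x; c y; al; be; p; q]); last first.
  by move=> nu; have [//|h] := avoid_dup _ nu; rewrite all6.
have D3' : D = 3.
  have := uniq_leq_size (enum_uniq C) (fun h _ => all6 h).
  by rewrite -cardE cardC /=; move: D3; clear; lia.
move: (u6); rewrite /= !inE !negb_or => /and5P[].
move=> /and5P[cxy cxal cxbe cxp cxq] /and4P[cyal cybe cyp cyq].
move=> /and3P[albe alp alq] /andP[bep beq] /andP[pq' _].
(* A second element of [ins] at an end of the edge is the colour forced on the
   other end. *)
have [be_in|] := boolP (be \in ins U a x); last first.
  move=> be_in; have [i2x|i1x] := ltnP 1 #|ins U a x|.
    have /set0Pn[t] : ins U a x :\ p != set0.
      by rewrite -card_gt0; move: i2x; rewrite (cardsD1 p); case: (_ \in _); clear; lia.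
    rewrite !inE => /andP[tp ti].
    have tcy : t = c y.
      have := all6 t; rewrite !inE (negPf tp) => /or4P[/eqP E|/eqP//|/eqP E|/or3P[/eqP E|//|/eqP E]].
      + move: ti; rewrite E => /imsetP[w wn cw].
        by have [_ _] := okx1 _ wn; rewrite -cw eqxx.
      + by have [_ _] := freeP fa; rewrite -E ti.
      + by move: be_in; rewrite -E ti.
      + by move: ti; rewrite E => /imsetP[w wn qw]; have := okx3 _ _ ynx wn; rewrite -qw eqxx.
    apply: (try a al be t q) => //; rewrite ?tcy //; first exact: n3.
    by apply: avoid_dup; rewrite //= !inE !negb_or eqxx /= ?andbF.
  have c2 : 1 < #|free U c a x|.
    by have := card_free c a xD; move: i1x; clear; lia.
  have /set0Pn[al'] : free U c a x :\ al != set0.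
    by rewrite -card_gt0; move: c2; rewrite (cardsD1 al) fa; clear; lia.
  rewrite in_setD1 => /andP[al'al fa'].
  have [al'c al'out al'in] := freeP fa'.
  have := all6 al'; rewrite !inE (negPf al'c) (negPf al'al) /= => /or4P[].
  - move=> /eqP al'cy; apply: (try a al' be p q) => //; [exact: n2|exact: n3|].
    by apply: avoid_dup; rewrite //= !inE !negb_or al'cy eqxx /= ?andbF.
  - by move=> /eqP al'be; apply: (common a al'); rewrite // al'be.
  - by move=> /eqP E; move: al'in; rewrite E i1.
  - by move=> /eqP E; move: al'out; rewrite E mem_outs.
have [al_in|] := boolP (al \in ins U a y); last first.
  move=> al_in; have [i2y|i1y] := ltnP 1 #|ins U a y|.
    have /set0Pn[t] : ins U a y :\ q != set0.
      by rewrite -card_gt0; move: i2y; rewrite (cardsD1 q); case: (_ \in _); clear; lia.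
    rewrite !inE => /andP[tq ti].
    have tcx : t = c x.
      have := all6 t; rewrite !inE (negPf tq) orbF => /or4P[/eqP//|/eqP E|/eqP E|/orP[/eqP E|/eqP E]].
      + move: ti; rewrite E => /imsetP[w wn cw].
        by have [_ _] := oky1 _ wn; rewrite -cw eqxx.
      + by move: al_in; rewrite -E ti.
      + by have [_ _] := freeP fb; rewrite -E ti.
      + by move: ti; rewrite E => /imsetP[w wn qw]; have := oky3 _ _ xny wn; rewrite -qw eqxx.
    apply: (try a al be p t) => //; rewrite ?tcx //; [|exact: n2|].
      by rewrite eq_sym.
    by apply: avoid_dup; rewrite //= !inE !negb_or eqxx /= ?andbF.
  have c2 : 1 < #|free U c a y|.
    by have := card_free c a yD; move: i1y; clear; lia.
  have /set0Pn[be'] : free U c a y :\ be != set0.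
    by rewrite -card_gt0; move: c2; rewrite (cardsD1 be) fb; clear; lia.
  rewrite in_setD1 => /andP[be'be fb'].
  have [be'c be'out be'in] := freeP fb'.
  have := all6 be'; rewrite !inE (negPf be'c) (negPf be'be) /= => /or4P[].
  - move=> /eqP be'cx; apply: (try a al be' p q) => //; [exact: n2|exact: n3|].
    by apply: avoid_dup; rewrite //= !inE !negb_or be'cx eqxx /= ?andbF.
  - by move=> /eqP be'al; apply: (common a be'); rewrite // be'al.
  - by move=> /eqP E; move: be'out; rewrite E mem_outs.
  - by move=> /eqP E; move: be'in; rewrite E i2.
(* No alternative is left: [be] occurs at [x] and [al] at [y] as second-incidence colours, and both
   vertices have degree two in [U]. Moving [al] and [be] onto the edge [x y] itself releases [q] at
   both ends, where it serves as a common free colour. *)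
have [x' x'n bex'] := imsetP be_in; have [y' y'n aly'] := imsetP al_in.
have yx' : y != x' by apply: contraNneq bep => E; rewrite bex' /p E.
have xy' : x != y' by apply: contraNneq alq => E; rewrite aly' /q E.
have nbx : nb U x = [set y; x'] by apply: nb_pair => //; move: xD; rewrite D3'.
have nby : nb U y = [set x; y'] by apply: nb_pair => //; move: yD; rewrite D3'.
pose a' u w := if (u == x) && (w == y) then al else
  if (u == y) && (w == x) then be else a u w.
have yx : (y == x) = false by rewrite eq_sym (negPf xy).
have x'x : (x' == x) = false.
  by move: x'n; rewrite nbE => /andP[_ /(edge_neq e_irr)]; rewrite eq_sym => /negPf.
have y'y : (y' == y) = false.
  by move: y'n; rewrite nbE => /andP[_ /(edge_neq e_irr)]; rewrite eq_sym => /negPf.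
have a'xy : a' x y = al by rewrite /a' !eqxx.
have a'yx : a' y x = be by rewrite /a' yx !eqxx.
have gU' : good U c a'.
  move=> z zU; have [->|zx] := eqVneq z x.
    apply: (recolour_ok (gU _ xU) nbx yx' fa (esym bex')) => //.
    + by rewrite /a' eqxx (eq_sym x') (negPf yx') (negPf xy).
    + by rewrite /a' x'x (eq_sym x') (negPf yx') bex'.
  have [->|zy] := eqVneq z y.
    apply: (recolour_ok (gU _ yU) nby xy' fb (esym aly')) => //.
    + by rewrite /a' yx (eq_sym y' x) (negPf xy') andbF.
    + by rewrite /a' y'y (eq_sym y') (negPf xy') aly'.
  apply: ok_eq (gU _ zU) => // w _.
  by rewrite /a' (negPf zx) (negPf zy) !andbF.
apply: (common a' q) => //.
- rewrite !inE !negb_or eq_sym cxq /=; apply/andP; split; apply/negP => /imsetP[w].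
    rewrite nbx => /set2P[]->; first by rewrite a'xy => /eqP; rewrite eq_sym (negPf alq).
    rewrite /a' eqxx (eq_sym x') (negPf yx') (negPf xy) /= => E.
    by have := okx2 _ _ ynx x'n E => /eqP; rewrite (negPf yx').
  rewrite nbx => /set2P[]->; first by rewrite a'yx => /eqP; rewrite eq_sym (negPf beq).
  rewrite /a' x'x (eq_sym x') (negPf yx') /= -bex' => /eqP.
  by rewrite eq_sym (negPf beq).
- rewrite !inE !negb_or eq_sym cyq /=; apply/andP; split; apply/negP => /imsetP[w].
    rewrite nby => /set2P[]->; first by rewrite a'yx => /eqP; rewrite eq_sym (negPf beq).
    rewrite /a' yx (eq_sym y' x) (negPf xy') andbF /= => E.
    by have := oky3 _ _ y'n xny; rewrite -E eqxx.
  rewrite nby => /set2P[]->; first by rewrite a'xy => /eqP; rewrite eq_sym (negPf alq).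
  rewrite /a' y'y (eq_sym y') (negPf xy') /= -aly' => /eqP.
  by rewrite eq_sym (negPf alq).
Qed.

(** Along the path [x u v y] the six incidences carry [al], [f], [p], [q], [g], [be] in this order.
    The values [q = al] and [p = be] are permitted, being the second incidences of [u] and of [v]
    respectively. *)
Lemma extend_path U c a u v x y al be f g p q cu cv :
  u \notin U -> v \notin U -> e u v -> x != y -> good U c a ->
  nb U u = [set x] -> nb U v = [set y] ->
  al \in free U c a x -> be \in free U c a y ->
  admits U c a x al f -> admits U c a y be g ->
  p \notin [:: f; al; q; g] -> q \notin [:: f; g; be] ->
  cu \notin [:: c x; al; f; p; q] -> cv \notin [:: c y; be; g; p; q; cu] ->
  colourable (v |: (u |: U)).
Proof.
move=> uU vU euv xy gU nu nv fa fb af ag.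
rewrite !inE !negb_or => /and4P[pf pal pq pg] /and3P[qf qg qbe].
move=> /and5P[cux cual cuf cup cuq] /and5P[cvy cvbe cvg cvp /andP[cvq cvu]].
have [xU ux] : x \in U /\ e u x by apply/andP; rewrite -nbE nu set11.
have [yU vy] : y \in U /\ e v y by apply/andP; rewrite -nbE nv set11.
have uv : u != v by exact: edge_neq euv.
have uy : ~~ e u y.
  by apply: contraNN xy => uy; rewrite eq_sym -in_set1 -nu nbE yU uy.
pose c1 := extc u cu c; pose a1 := exta u (fun=> al) (fun=> f) a.
have gU1 : good (u |: U) c1 a1.
  apply: extend => //; rewrite nu.
  - by move=> z /set1P ->; rewrite eq_sym.
  - by move=> z w /set1P -> /set1P ->.
  - by move=> z w _ _; case: af.
  - by rewrite imset_set1 cards1.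
have vU1 : v \notin u |: U by rewrite in_setU1 negb_or eq_sym uv.
have nv1 : nb (u |: U) v = [set u; y].
  apply/setP => z; rewrite !inE; case: eqVneq => [->|zu] /=; first by rewrite e_sym.
  by rewrite -nbE nv inE.
have [outy iny cy] : [/\ outs (u |: U) a1 y = outs U a y,
    ins (u |: U) a1 y = ins U a y & c1 y = c y] by exact: extend_away.
have xu : (x == u) = false by apply: contraNF uU => /eqP <-.
have yu : (y == u) = false by apply: contraNF uU => /eqP <-.
have nu1 : nb (u |: U) u = [set x].
  rewrite -nu; apply/setP => z; rewrite !inE.
  by case: eqVneq => //= ->; rewrite e_irr andbF.
have outu : outs (u |: U) a1 u = [set f].
  by rewrite /outs nu1 imset_set1 /a1 /exta xu eqxx.
have inu : ins (u |: U) a1 u = [set al].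
  by rewrite /ins nu1 imset_set1 /a1 /exta eqxx.
have c1u : c1 u = cu by rewrite /c1 /extc eqxx.
have freey : be \in free (u |: U) c1 a1 y by move: fb; rewrite /free outy iny cy.
have admy : admits (u |: U) c1 a1 y be g by move: ag; rewrite /admits outy iny cy.
apply: (@extend_two (u |: U) c1 a1 v u y p be q g cv) => //.
- by rewrite eq_sym yu.
- by rewrite /free outu inu c1u !inE !negb_or eq_sym cup pf pal.
- rewrite /admits outu inu c1u !inE eq_sym cuq qf eq_sym pq; split=> //.
  by rewrite cards2; case: (_ != _).
- by rewrite eq_sym.
- rewrite !inE !negb_or c1u {1}/c1 /extc yu cvu cvy cvp cvbe cvq cvg //.
Qed.

Lemma extend_adjacent U u v x y : 2 < D -> u \notin U -> v \notin U -> e u v ->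
  x != y -> nb U u = [set x] -> nb U v = [set y] -> colourable U ->
  colourable (v |: (u |: U)).
Proof.
move=> D3 uU vU euv xy nu nv [c [a gU]].
have C6 : 6 <= #|C| by rewrite cardC; move: D3; clear; lia.
have [xU ux] : x \in U /\ e u x by apply/andP; rewrite -nbE nu set11.
have [yU vy] : y \in U /\ e v y by apply/andP; rewrite -nbE nv set11.
have xD := nb_lt uU ux; have yD := nb_lt vU vy.
have ix : #|ins U a x| <= 2 by case: (gU _ xU).
have iy : #|ins U a y| <= 2 by case: (gU _ yU).
have [al fa] := free_ex c xD ix; have [be fb] := free_ex c yD iy.
have few (s : seq C) : size s < 6 -> exists h, h \notin s.
  by move=> s6; apply: avoid; apply: leq_trans C6.
(* A coincidence is forced so that each remaining choice has at most five colours to avoid, out of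
   at least six: [q = c y] when [al = be], where [cv] has to avoid [c y] anyway; otherwise [p = be]
   and [q = al]. *)
have [albe|albe] := eqVneq al be.
  have [f af fcy] := admits_ex (c y) xD (gU _ xU) fa.
  have [g ag _] := admits_ex be yD (gU _ yU) fb.
  have [fc _ fal _] := af; have [gc _ gbe _] := ag.
  have [bec _ _] := freeP fb.
  have [p pP] := few [:: f; al; c y; g] isT.
  have [cu cuP] := few [:: c x; al; f; p; c y] isT.
  have [cv cvP] := few [:: c y; be; g; p; cu] isT.
  apply: (extend_path uU vU euv xy gU nu nv fa fb af ag pP _ cuP _ (cv := cv)).
    by rewrite !inE !negb_or eq_sym fcy eq_sym gc eq_sym bec.
  by move: cvP; rewrite !inE; case: (cv == c y).
have [f af fbe] := admits_ex be xD (gU _ xU) fa.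
have [g ag gal] := admits_ex al yD (gU _ yU) fb.
have [_ _ fal _] := af; have [_ _ gbe _] := ag.
have [cu] := few [:: c x; al; f; be] isT.
rewrite !inE !negb_or => /and4P[cu1 cu2 cu3 cu4].
have [cv] := few [:: c y; be; g; al; cu] isT.
rewrite !inE !negb_or => /and5P[cv1 cv2 cv3 cv4 cv5].
apply: (extend_path uU vU euv xy gU nu nv fa fb af ag
  (p := be) (q := al) (cu := cu) (cv := cv)).
- by rewrite !inE !negb_or eq_sym fbe eq_sym albe eq_sym gbe.
- by rewrite !inE !negb_or eq_sym fal eq_sym gal albe.
- by rewrite !inE !negb_or cu1 cu2 cu3 cu4.
- by rewrite !inE !negb_or cv1 cv2 cv3 cv4 cv5.
Qed.

(** The cycle is a whole component of the graph on [U]. Its vertices and incidences, in cyclic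
    order, are coloured by a cyclic word of length three times that of the cycle, so that conflicts
    are between positions at distance at most 3. *)
Lemma extend_cycle U s (y : nat -> T) : 1 < D -> 0 < s ->
  (forall i j, i <= s.+1 -> j <= s.+1 -> y i = y j -> i = j) ->
  (forall i, i <= s.+1 -> y i \in U) ->
  (forall i x, i <= s.+1 -> x \in nb U (y i) ->
     x = y (if i == s.+1 then 0 else i.+1) \/ x = y (if i == 0 then s.+1 else i.-1)) ->
  colourable (U :\: [set x in [seq y i | i <- iota 0 s.+2]]) -> colourable U.
Proof.
move=> D2 s0 y_inj yU ynb [c [a gU]].
pose nxt i := if i == s.+1 then 0 else i.+1.
pose prv i := if i == 0 then s.+1 else i.-1.
pose Y := [seq y i | i <- iota 0 s.+2]; pose idx x := index x Y.
(* The positive integers not of the form [4 m + 5 b] are 1, 2, 3, 6, 7 and 11; [N] is a multiple of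
   3 and at least 9. The smallest possible [b] is [N %% 4]. *)
pose N := 3 * s.+2; pose b := N %% 4; pose m := (N - 5 * b) %/ 4.
have NE : N = 4 * m + 5 * b by rewrite /m /b /N; move: s0; clear; lia.
have uY : uniq Y.
  rewrite map_inj_in_uniq ?iota_uniq // => i j; rewrite !mem_iota !add0n !ltnS.
  exact: y_inj.
have idxE i : i <= s.+1 -> idx (y i) = i.
  move=> is_; rewrite /idx; have iY : i < size Y by rewrite size_map size_iota.
  have -> : y i = nth (y 0) Y i by rewrite (nth_map 0) ?size_iota ?nth_iota.
  by rewrite index_uniq.
have memY i : i <= s.+1 -> y i \in Y by move=> is_; apply: map_f; rewrite mem_iota.
have [c0 _] : exists h : C, h \notin [::] by apply: avoid; rewrite cardC addn3.
pose col j := nth c0 (enum C) (word m j).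
pose c' x := if x \in Y then col (3 * idx x) else c x.
(* Position [3 i] is the vertex [y i]; positions [3 i + 1] and [3 i + 2] are the two incidences of
   the edge from [y i] to its successor. *)
pose a' x z := if x \in Y then
  (if z == y (nxt (idx x)) then col (3 * idx x + 1) else col (3 * prv (idx x) + 2))
  else a x z.
have colN j k : j < N -> k < N -> (j < k <= j + 3) || (k < j) && (k + N <= j + 3) ->
    col j != col k /\ col k != col j.
  move=> jN kN jk; suff h : col j != col k by split; rewrite // eq_sym.
  have C5 : 5 <= size (enum C) by rewrite -cardE cardC; move: D2; clear; lia.
  rewrite nth_uniq ?enum_uniq ?(leq_trans (word_lt _ _) C5) //.
  by apply: word_cyclic NE _ jN kN jk; rewrite /N; clear; lia.
exists c', a' => x xU; have [xY|xY] := boolP (x \in Y); last first.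
  apply: (@ok_eq (U :\: [set x in Y]) U c c' a a').
  - apply/setP => z; rewrite !nbE in_setD in_set.
    have [zY|//] := boolP (z \in Y); apply/negbTE/negP => /andP[zU xz]; move/mapP: zY xz => [i]; rewrite mem_iota add0n ltnS.
    move=> is_ -> xz; have := ynb i x is_; rewrite nbE xU e_sym xz => /(_ isT) [] xE;
      by move: xY; rewrite xE memY //; case: ifP; move: is_; clear; lia.
  - by rewrite /c' (negPf xY).
  - move=> z; rewrite nbE in_setD in_set => /andP[/andP[zY _] _].
    by rewrite /c' /a' (negPf xY) (negPf zY).
  - by apply: gU; rewrite in_setD in_set xY xU.
move/mapP: xY xU => [i]; rewrite mem_iota add0n ltnS => is_ -> _ {x}.
set k := nxt i; set l := prv i.
have ks : k <= s.+1 by rewrite /k /nxt; case: ifP; move: is_; clear; lia.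
have ls : l <= s.+1 by rewrite /l /prv; case: ifP; move: is_; clear; lia.
have kP : (i = s.+1 /\ k = 0) \/ (i < s.+1 /\ k = i.+1).
  rewrite /k /nxt; case: eqVneq; move: is_; clear; lia.
have lP : (i = 0 /\ l = s.+1) \/ (0 < i /\ l = i.-1).
  rewrite /l /prv; case: eqVneq; move: is_; clear; lia.
have nk : nxt k != i by rewrite /nxt; case: (eqVneq k s.+1); move: kP is_ s0; clear; lia.
have pk : prv k = i by rewrite /prv; case: eqVneq; move: kP is_ s0; clear; lia.
have nl : nxt l = i by rewrite /nxt; case: eqVneq; move: lP is_ s0; clear; lia.
have lk : l != k by move: lP kP s0; clear; lia.
have nks : nxt k <= s.+1 by rewrite /nxt; case: eqVneq; move: ks; clear; lia.
have yne p q : p <= s.+1 -> q <= s.+1 -> p != q -> (y p == y q) = false.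
  by move=> ps qs pq; apply: contraNF pq => /eqP /y_inj ->.
have cE j : j <= s.+1 -> c' (y j) = col (3 * j).
  by move=> js; rewrite /c' memY // idxE.
have aik : a' (y i) (y k) = col (3 * i + 1) by rewrite /a' memY // idxE // eqxx.
have ail : a' (y i) (y l) = col (3 * l + 2).
  by rewrite /a' memY // idxE // yne.
have aki : a' (y k) (y i) = col (3 * i + 2).
  by rewrite /a' memY // idxE // yne ?pk // eq_sym.
have ali : a' (y l) (y i) = col (3 * l + 1).
  by rewrite /a' memY // idxE // nl eqxx.
have nbi x : x \in nb U (y i) -> x = y k \/ x = y l by exact: ynb.
have diff j j' : j < N -> j' < N ->
   [|| j < j' <= j + 3, (j' < j) && (j' + N <= j + 3), j' < j <= j' + 3
     | (j < j') && (j + N <= j' + 3)] -> col j != col j'.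
  move=> jN jN' /or4P h.
  have [h1|h2] : ((j < j' <= j + 3) || (j' < j) && (j' + N <= j + 3)) \/
      ((j' < j <= j' + 3) || (j < j') && (j + N <= j' + 3)).
    by case: h => ->; rewrite ?orbT; [left|left|right|right].
  - by have [] := colN _ _ jN jN' h1.
  - by have [] := colN _ _ jN' jN h2.
have {}diff j j' : j < N -> j' < N ->
   [|| j < j' <= j + 3, (j' < j) && (j' + N <= j + 3), j' < j <= j' + 3
     | (j < j') && (j + N <= j' + 3)] -> col j <> col j'.
  by move=> h1 h2 h3; apply/eqP/diff.
rewrite /N in diff; split.
- move=> x /nbi[]->; rewrite ?aik ?ail ?aki ?ali !cE //; split; apply/eqP/diff;
    move: kP lP is_ s0; clear; lia.
- move=> x z /nbi[]-> /nbi[]-> //; rewrite ?aik ?ail => E; exfalso; move: E; apply: diff;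
    move: kP lP is_ s0; clear; lia.
- move=> x z /nbi[]-> /nbi[]->; rewrite ?aik ?ail ?aki ?ali; apply/eqP/diff;
    move: kP lP is_ s0; clear; lia.
- apply: (@leq_trans #|[set y k; y l]|).
    apply: leq_trans (leq_imset_card _ _) _; apply: subset_leq_card.
    by apply/subsetP => x /nbi[]->; rewrite !inE eqxx ?orbT.
  by rewrite cards2; case: (_ != _).
Qed.

(** * Induction on the set of coloured vertices *)

Hypothesis noK4 : ~ K4_minor e.
Hypothesis noK23 : ~ K23_minor e.

Lemma nb_remove U v : nb (U :\ v) v = nb U v.
Proof.
by apply/setP => x; rewrite !inE; case: eqVneq => //= ->; rewrite e_irr andbF.
Qed.

Theorem colourable_all U : colourable U.
Proof.
have [n] := ubnP #|U|; elim: n U => // n IH U Un.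
have [U0|[x0 x0U]] := set_0Vmem U.
  have [h _] : exists h : C, h \notin [::] by apply: avoid; rewrite cardC addn3.
  by exists (fun=> h), (fun _ _ => h) => x; rewrite U0 inE.
have [v /andP[vU v1]|noleaf] := pickP [pred v | (v \in U) && (#|nb U v| <= 1)].
  rewrite -(setD1K vU); apply: extend_pendant; rewrite ?setD11 ?nb_remove //.
  by apply: IH; move: Un; rewrite (cardsD1 v) vU; clear; lia.
have nbw x : x \in U -> [set z | induced e U x z] = nb U x.
  by move=> xU; apply/setP => z; rewrite in_set nbE /induced /= xU andbC.
have [s [y [s0 y_inj ye yends ynb]]] :
    exists s (y : nat -> T), ear (induced e U) s y.
  apply: (@ear_exists T (induced e U) _ _ U).
  - by move=> x z; rewrite /induced /= e_sym; congr (_ && _); exact: andbC.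
  - by move=> x; rewrite /induced /= e_irr.
  - by move=> x z /and3P[].
  - by move=> x xU; rewrite nbw // ltnNge; have := noleaf x; rewrite /= xU /= => ->.
  - by move=> h; apply: noK4; apply: K4_minorS h => x z /and3P[].
  - by move=> h; apply: noK23; apply: K23_minorS h => x z /and3P[].
  - by exists x0.
have ye' i : i <= s -> e (y i) (y i.+1) by move=> /ye/and3P[].
have yU i : i <= s.+1 -> y i \in U.
  case: i => [_|i]; first by have /and3P[] := yends.
  by rewrite ltnS => /ye/and3P[].
have {}ynb i x : 0 < i <= s -> x \in nb U (y i) -> x = y i.-1 \/ x = y i.+1.
  move=> is_; rewrite nbE => /andP[xU ix]; apply: (ynb _ _ is_).
  by rewrite /induced /= ix xU yU //; move: is_; clear; lia.
have yne p q : p <= s.+1 -> q <= s.+1 -> p != q -> y p != y q.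
  by move=> ps qs; apply: contra_neq => /y_inj ->.
(* For [D <= 2] every degree is exactly two, so the ends of the ear have no neighbours off the cycle
   either, and the ear is a whole component. *)
have [D3|D2] := ltnP 2 D; last first.
  have n2 x : x \in U -> #|nb U x| = 2.
    move=> xU; have := noleaf x; rewrite /= xU /= => /negbT; rewrite -ltnNge => n1.
    have : #|nb U x| <= #|[set z | e x z]|.
      by apply: subset_leq_card; apply/subsetP => z; rewrite !inE => /andP[].
    by have := deg_le x; move: D2 n1; clear; lia.
  have D1 : 1 < D.
    apply: leq_trans (deg_le x0); rewrite -(n2 _ x0U); apply: subset_leq_card.
    by apply/subsetP => z; rewrite !inE => /andP[].
  have pair x p q : x \in U -> p \in nb U x -> q \in nb U x -> p != q ->
      forall z, z \in nb U x -> z = p \/ z = q.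
    move=> xU px qx pq z; rewrite (nb_pair px qx pq) ?n2 //.
    by move=> /set2P.
  apply: (@extend_cycle U s y) => //.
    move=> i x is_; have [->|i0] := eqVneq i 0.
      apply: (pair (y 0)).
      + exact: yU.
      + by rewrite nbE yU // ye'.
      + by rewrite nbE yU //; have /and3P[] := yends.
      + by apply: yne => //; move: s0; clear; lia.
    have [->|is1] := eqVneq i s.+1.
      apply: (pair (y s.+1)).
      + exact: yU.
      + by rewrite nbE yU // e_sym; have /and3P[] := yends.
      + by rewrite nbE yU // e_sym ye'.
      + by apply: yne => //; move: s0; clear; lia.
    by move=> xn; have [|->|->] := ynb i x _ xn; [move: is_ i0 is1; clear; lia|right|left].
  apply: IH; apply: leq_trans (_ : #|U| <= n); last by rewrite -ltnS.
  apply: proper_card; apply/properP; split; first exact: subsetDl.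
  by exists (y 0); [exact: yU|rewrite !inE /= eqxx].
have [s1|s2] := leqP s 1.
  have {s1}s1 : s = 1 by move: s0 s1; clear; lia.
  subst s; have y1U := yU 1 isT.
  rewrite -(setD1K y1U); apply: (@extend_triangle _ _ (y 0) (y 2)) => //.
  - by rewrite setD11.
  - rewrite nb_remove; apply/setP => x; apply/idP/idP.
      by move=> /(ynb 1 x isT)[]->; rewrite !inE eqxx ?orbT.
    by move=> /set2P[]->; rewrite nbE yU //= ?ye' // e_sym ye'.
  - by have /and3P[] := yends.
  - by apply: IH; move: Un; rewrite (cardsD1 (y 1)) y1U; clear; lia.
have y1U : y 1 \in U by apply: yU; move: s2; clear; lia.
have y2U : y 2 \in U by apply: yU; move: s2; clear; lia.
have y12 : y 1 != y 2 by apply: yne; move: s2; clear; lia.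
have y2U' : y 2 \in U :\ y 1 by rewrite in_setD1 eq_sym y12.
pose W := U :\ y 1 :\ y 2.
have UW : U = y 2 |: (y 1 |: W).
  rewrite setUCA /W setD1K ?setD1K //.
rewrite UW; apply: (@extend_adjacent _ _ _ (y 0) (y 3)) => //.
- by rewrite !inE eqxx andbF.
- by rewrite !inE eqxx.
- by apply: ye'; move: s2; clear; lia.
- by apply: yne; move: s2; clear; lia.
- apply/setP => x; rewrite !inE; apply/idP/eqP.
    move=> /andP[/and3P[x2 x1 xU] ex].
    have [||//|x2'] := ynb 1 x _ _; [move: s2; clear; lia|by rewrite nbE xU|].
    by rewrite x2' eqxx in x2.
  move=> ->; rewrite !yne ?yU //; try by move: s2; clear; lia.
  by rewrite e_sym ye'.
- apply/setP => x; rewrite !inE; apply/idP/eqP.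
    move=> /andP[/and3P[x2 x1 xU] ex].
    have [||x1'|//] := ynb 2 x _ _; [move: s2; clear; lia|by rewrite nbE xU|].
    by rewrite x1' eqxx in x1.
  move=> ->; rewrite !yne ?yU ?ye' //; by move: s2; clear; lia.
- by apply: IH; move: Un; rewrite (cardsD1 (y 1)) y1U (cardsD1 (y 2)) y2U' -/W; clear; lia.
Qed.

End Colouring.

(** * From the colours [a x y] to colourings of [third G] *)

Section Bridge.
Variable G : sgraph.
Implicit Types (i j : incidence G) (u v : G).

Lemma incidence_ends i : adj (val i).1 (other_end i) /\
  val i = ((val i).1, [set (val i).1; other_end i]%SET).
Proof.
have [u [v [uv ei]]] := incidenceP i.
by rewrite (other_endE uv ei) ei.
Qed.

Lemma incidence_inj i j : (val i).1 = (val j).1 -> other_end i = other_end j -> i = j.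
Proof.
move=> u v; apply: val_inj.
by have [_ ->] := incidence_ends i; have [_ ->] := incidence_ends j; rewrite u v.
Qed.

Lemma third_adj_inr i j : third_adj (inr i) (inr j) ->
  (val j).1 = other_end i /\ other_end j = (val i).1.
Proof.
move=> /andP[ij /eqP eij].
have [ai Ei] := incidence_ends i; have [aj Ej] := incidence_ends j.
have setE : [set (val i).1; other_end i]%SET = [set (val j).1; other_end j]%SET.
  by move: eij; rewrite Ei Ej.
have ujs : (val j).1 \in [set (val i).1; other_end i]%SET by rewrite setE set21.
have vjs : other_end j \in [set (val i).1; other_end i]%SET by rewrite setE set22.
have ujv : (val j).1 != other_end j by apply: contraTneq aj => ->; rewrite adj_irr.
move: ujs vjs => /set2P[uj|uj] /set2P[vj|vj] //.
- by rewrite uj vj eqxx in ujv.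
- by move: ij; rewrite (incidence_inj (esym uj) (esym vj)) eqxx.
- by rewrite uj vj eqxx in ujv.
Qed.

(** Two incidences that share nothing but their other end are absent: they are at distance 4 in
    [third], which is why second incidences of a vertex may share a colour. *)
Definition conflict (x y : third G) : Prop :=
  match x, y with
  | inl u, inl v => adj u v
  | inl u, inr i | inr i, inl u => u = (val i).1 \/ u = other_end i
  | inr i, inr j => [\/ (val i).1 = (val j).1, (val i).1 = other_end j
                      | other_end i = (val j).1]
  end.

Lemma dist_le3_conflict (x y : third G) : x <> y -> dist_le 3 x y -> conflict x y.
Proof.
have VI u i : third_adj (inl u) (inr i) -> u = (val i).1 by move/eqP.
have IV u i : third_adj (inr i) (inl u) -> u = (val i).1 by move/eqP.
move=> xy [p [pth lst sz]].
case: p pth lst sz => [|z1 [|z2 [|z3 [|]]]] //=.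
- rewrite andbT => + e1 _; rewrite e1; case: x xy => [u|i]; case: y {e1} => [v|j] //= _.
  + by move=> /VI; left.
  + by move=> /IV; left.
  + by move=> /third_adj_inr[-> _]; constructor 3.
- rewrite andbT => /andP[+ +] e1 _; rewrite e1.
  case: x xy => [u|i]; case: z1 => [w|k]; case: y {e1} => [v|j] //= xy.
  + by move=> /VI uk /IV vk; case: xy; rewrite uk vk.
  + by move=> /VI-> /third_adj_inr[_ ->]; right.
  + by move=> /IV-> /VI; constructor 1.
  + by move=> /third_adj_inr[<- _] /IV ->; right.
  + move=> /third_adj_inr[ki ik] /third_adj_inr[jk kj]; case: xy; congr inr.
    by apply: incidence_inj; rewrite ?jk ?kj ?ik ?ki.
rewrite andbT => /and3P[+ + +] e1 _; rewrite e1.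
case: x xy => [u|i]; case: z1 => [w|k]; case: z2 => [w'|l]; case: y {e1} => [v|j] //= xy.
- move=> /VI-> /IV-> /VI; by left.
- move=> /VI-> /third_adj_inr[lk kl] /IV ->.
  by have [+ _] := incidence_ends k; rewrite lk.
- move=> /VI-> /third_adj_inr[lk kl] /third_adj_inr[jl lj].
  by left; rewrite jl kl.
- by move=> /IV-> /VI wl /IV ->; left; rewrite wl.
- by move=> /IV-> /VI-> /third_adj_inr[_ lj]; constructor 2.
- by move=> /third_adj_inr[ki _] /IV wk /VI wj; constructor 3; rewrite -ki -wk.
- move=> /third_adj_inr[ki ik] /third_adj_inr[lk kl] /IV ->; left.
  by rewrite lk ik.
- move=> /third_adj_inr[ki ik] /third_adj_inr[lk kl] /third_adj_inr[jl lj].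
  by constructor 2; rewrite lj lk ik.
Qed.

Lemma good_vi_colorable k (c : G -> 'I_k) a :
  good (@adj G) [set: G]%SET c a -> vi_colorable G 2 k.
Proof.
move=> gc.
have nbG u v : adj u v -> v \in nb (@adj G) [set: G]%SET u by rewrite nbE inE.
have {}gc u := gc u (in_setT u).
pose col (x : third G) := match x with
  inl v => c v | inr i => a (val i).1 (other_end i) end.
exists col; split.
  move=> x y xy /(dist_le3_conflict xy); case: x y xy => [u|i] [v|j] xy /=.
  - move=> uv; have [h _ _ _] := gc u; have [+ _ _] := h v (nbG _ _ uv).
    by move/eqP/nesym.
  - have [ij _] := incidence_ends j; have ji := ij; rewrite adj_sym in ji.
    move=> [->|->].
      by have [h _ _ _] := gc (val j).1; have [_ /eqP/nesym] := h _ (nbG _ _ ij).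
    by have [h _ _ _] := gc (other_end j); have [_ _ /eqP/nesym] := h _ (nbG _ _ ji).
  - have [ij _] := incidence_ends i; have ji := ij; rewrite adj_sym in ji.
    move=> [->|->].
      by have [h _ _ _] := gc (val i).1; have [_ /eqP] := h _ (nbG _ _ ij).
    by have [h _ _ _] := gc (other_end i); have [_ _ /eqP] := h _ (nbG _ _ ji).
  have [ai _] := incidence_ends i; have [aj _] := incidence_ends j.
  have ai' := ai; have aj' := aj; rewrite adj_sym in ai'; rewrite adj_sym in aj'.
  move=> [ij|ij|ij].
  - have [_ h _ _] := gc (val i).1; rewrite -ij in aj *.
    move=> /(h _ _ (nbG _ _ ai) (nbG _ _ aj)) e2.
    by case: xy; congr inr; apply: incidence_inj.
  - have [_ _ h _] := gc (val i).1; rewrite -ij in aj' *.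
    by apply/eqP; exact: h (nbG _ _ ai) (nbG _ _ aj').
  - have [_ _ h _] := gc (other_end i); rewrite -ij in aj *.
    by apply/eqP; rewrite eq_sym; exact: h (nbG _ _ aj) (nbG _ _ ai').
move=> v; have [_ _ _] := gc v; apply: leq_trans; apply: subset_leq_card.
apply/fintype.subsetP => b /imsetP[i i2 ->]; move: i2; rewrite inE.
move=> /existsP[u /andP[]]; rewrite inE adj_sym => uv /eqP ei.
rewrite /col (other_endE uv ei) ei; apply/imsetP; exists u => //.
by rewrite nbE inE adj_sym.
Qed.

End Bridge.

From mathcomp Require Import all_order all_algebra.
From mathcomp Require Import ring lra.

Import Order.TTheory GRing.Theory Num.Theory.
Local Open Scope ring_scope.

(** * Parity of crossings *)

Section Orientation.
Variable R : realFieldType.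
Implicit Types p q r s : R * R.

Definition area p q r : R :=
  (q.1 - p.1) * (r.2 - p.2) - (q.2 - p.2) * (r.1 - p.1).

Definition ccw p q r := 0 < area p q r.

Definition crossing p q r s :=
  (ccw p q r (+) ccw p q s) && (ccw r s p (+) ccw r s q).

Lemma crossingC p q r s : crossing p q r s = crossing r s p q.
Proof. exact: andbC. Qed.

(** The function [area r s] is affine along [p q] and changes sign between the ends, so it vanishes
    at the parameter given by the ratio of its end values; the same holds with the segments
    exchanged. *)
Lemma crossing_meet p q r s : crossing p q r s ->
  exists2 ab : R * R, (0 <= ab.1 <= 1) && (0 <= ab.2 <= 1) &
    (p.1 + ab.1 * (q.1 - p.1) = r.1 + ab.2 * (s.1 - r.1)) /\
    (p.2 + ab.1 * (q.2 - p.2) = r.2 + ab.2 * (s.2 - r.2)).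
Proof.
have unit_ratio (x y : R) : (0 < x) (+) (0 < y) ->
    x - y != 0 /\ 0 <= x / (x - y) <= 1.
  have [x0|x0] := ltP 0 x; have [y0|y0] //= := ltP 0 y => _.
    have xy : 0 < x - y by lra.
    by rewrite divr_ge0 ?(ltW xy) ?(ltW x0)//= ler_pdivrMr // mul1r; split; [rewrite gt_eqF|lra].
  have xy : 0 < y - x by lra.
  rewrite -(opprB y x) invrN mulrN -mulNr divr_ge0 ?(ltW xy) ?oppr_ge0//=.
  by rewrite ler_pdivrMr // mul1r; split; [rewrite oppr_eq0 gt_eqF|lra].
move=> /andP[/unit_ratio[n1 h1] /unit_ratio[n2 h2]].
exists (area r s p / (area r s p - area r s q),
        area p q r / (area p q r - area p q s)); first by rewrite h1 h2.
move: n1 n2; rewrite /area /= => n1 n2.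
by split; field; rewrite n1 n2.
Qed.

Definition in_triangle a x y z :=
  (ccw x y a == ccw y z a) && (ccw y z a == ccw z x a).

Definition generic3 p q r := area p q r != 0.

Lemma ccw_swap12 p q r : generic3 p q r -> ccw q p r = ~~ ccw p q r.
Proof.
rewrite /generic3 /ccw => h; rewrite -leNgt.
have -> : area q p r = - area p q r by rewrite /area; ring.
by rewrite oppr_gt0 lt_neqAle h.
Qed.

Lemma ccw_rot p q r : ccw q r p = ccw p q r.
Proof. by rewrite /ccw; congr (_ < _); rewrite /area; ring. Qed.

(** The four areas have alternating sum zero, so their signs cannot alternate. *)
Lemma sign4 p q r s :
  generic3 p q r -> generic3 p q s -> generic3 p r s -> generic3 q r s ->
  ~~ [&& ccw q r s (+) ccw p r s, ccw p r s (+) ccw p q s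
       & ccw p q s (+) ccw p q r].
Proof.
have E : area q r s - area p r s + area p q s - area p q r = 0
  by rewrite /area; ring.
rewrite /generic3 /ccw; move: E.
move: (area q r s) (area p r s) (area p q s) (area p q r) => a b c d E.
move=> hd hc hb ha.
case: (ltgtP 0 a) ha => // ha _; case: (ltgtP 0 b) hb => // hb _;
case: (ltgtP 0 c) hc => // hc _; case: (ltgtP 0 d) hd => // hd _ //=; lra.
Qed.

(** This is the three-term Grassmann-Plücker relation for the vectors from [p]: its three signed
    products cannot all have the same sign. *)
Lemma sign5 p q r s t :
  generic3 p q r -> generic3 p q s -> generic3 p q t ->
  generic3 p r s -> generic3 p r t -> generic3 p s t ->
  let x := ccw p q r (+) ccw p s t in
  let y := ccw p q s (+) ccw p r t in
  let z := ccw p q t (+) ccw p r s in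
  ~~ ((x (+) y) && (y (+) z)).
Proof.
have E : area p q r * area p s t - area p q s * area p r t
       + area p q t * area p r s = 0 by rewrite /area; ring.
rewrite /generic3 /ccw; move: E.
move: (area p q r) (area p s t) (area p q s) (area p r t) (area p q t)
  (area p r s) => a a' b b' c c' E.
have pr (u v : R) : u != 0 -> v != 0 ->
    if (0 < u) (+) (0 < v) then u * v < 0 else 0 < u * v.
  case: (ltgtP 0 u) => // hu _; case: (ltgtP 0 v) => //= hv _.
  - by rewrite mulr_gt0.
  - by rewrite pmulr_rlt0.
  - by rewrite nmulr_rlt0.
  - by rewrite nmulr_rgt0.
move=> ha hb hc hc' hb' ha'.
move: (pr _ _ ha ha') (pr _ _ hb hb') (pr _ _ hc hc') => /=.
by do 3!case: (_ (+) _) => //=; lra.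
Qed.

Definition generic5 a b c d e :=
  [/\ generic3 a b c, generic3 a b d, generic3 a b e, generic3 a c d
    & generic3 a c e] /\
  [/\ generic3 a d e, generic3 b c d, generic3 b c e, generic3 b d e
    & generic3 c d e].

Lemma generic3_swap12 p q r : generic3 p q r -> generic3 q p r.
Proof.
rewrite /generic3; have -> : area q p r = - area p q r by rewrite /area; ring.
by rewrite oppr_eq0.
Qed.

Lemma generic3_rot p q r : generic3 p q r -> generic3 q r p.
Proof.
by rewrite /generic3; have -> : area q r p = area p q r by rewrite /area; ring.
Qed.

(* Every statement about the order type of five points is reduced to a finite
   check on the ten orientation bits, constrained by [sign4] and [sign5]. *)
Lemma five_points a b c d e : generic5 a b c d e ->
  (crossing a b c d (+) crossing a b d e (+) crossing a b e c =
     in_triangle a c d e (+) in_triangle b c d e) /\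
  (crossing a b c d (+) crossing a c b d (+) crossing a d b c
   (+) crossing a b c e (+) crossing a c b e (+) crossing a e b c
   (+) crossing a b d e (+) crossing a d b e (+) crossing a e b d
   (+) crossing a c d e (+) crossing a d c e (+) crossing a e c d
   (+) crossing b c d e (+) crossing b d c e (+) crossing b e c d).
Proof.
move=> [[abc abd abe acd ace] [ade bcd bce bde cde]].
have s1 := sign4 abc abd acd bcd; have s2 := sign4 abc abe ace bce.
have s3 := sign4 abd abe ade bde; have s4 := sign4 acd ace ade cde.
have s5 := sign4 bcd bce bde cde.
have t1 := sign5 abc abd abe acd ace ade.
have t2 := sign5 (generic3_swap12 abc) (generic3_swap12 abd)
  (generic3_swap12 abe) bcd bce bde.
have r (x y z : R * R) : generic3 x y z -> generic3 z x y.
  by move=> ?; do 2! apply: generic3_rot.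
have t3 := sign5 (r _ _ _ abc) (generic3_swap12 acd)
  (generic3_swap12 ace) (generic3_swap12 bcd) (generic3_swap12 bce) cde.
have t4 := sign5 (r _ _ _ abd) (r _ _ _ acd) (generic3_swap12 ade)
  (r _ _ _ bcd) (generic3_swap12 bde) (generic3_swap12 cde).
have t5 := sign5 (r _ _ _ abe) (r _ _ _ ace) (r _ _ _ ade)
  (r _ _ _ bce) (r _ _ _ bde) (r _ _ _ cde).
have cyc x y z : generic3 x y z ->
  [/\ ccw y z x = ccw x y z, ccw z x y = ccw x y z, ccw y x z = ~~ ccw x y z,
      ccw x z y = ~~ ccw x y z & ccw z y x = ~~ ccw x y z].
  move=> g; rewrite -(ccw_swap12 g) -(ccw_rot x y z); split=> //.
  - exact: ccw_rot.
  - exact: ccw_rot.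
  - by rewrite -(ccw_rot y x z) ccw_rot.
move: t1 t2 t3 t4 t5 s1 s2 s3 s4 s5; rewrite /= /crossing /in_triangle.
case: (cyc _ _ _ abc) => e1 e2 e3 e4 e5; rewrite ?e1 ?e2 ?e3 ?e4 ?e5 {e1 e2 e3 e4 e5}.
case: (cyc _ _ _ abd) => e1 e2 e3 e4 e5; rewrite ?e1 ?e2 ?e3 ?e4 ?e5 {e1 e2 e3 e4 e5}.
case: (cyc _ _ _ abe) => e1 e2 e3 e4 e5; rewrite ?e1 ?e2 ?e3 ?e4 ?e5 {e1 e2 e3 e4 e5}.
case: (cyc _ _ _ acd) => e1 e2 e3 e4 e5; rewrite ?e1 ?e2 ?e3 ?e4 ?e5 {e1 e2 e3 e4 e5}.
case: (cyc _ _ _ ace) => e1 e2 e3 e4 e5; rewrite ?e1 ?e2 ?e3 ?e4 ?e5 {e1 e2 e3 e4 e5}.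
case: (cyc _ _ _ ade) => e1 e2 e3 e4 e5; rewrite ?e1 ?e2 ?e3 ?e4 ?e5 {e1 e2 e3 e4 e5}.
case: (cyc _ _ _ bcd) => e1 e2 e3 e4 e5; rewrite ?e1 ?e2 ?e3 ?e4 ?e5 {e1 e2 e3 e4 e5}.
case: (cyc _ _ _ bce) => e1 e2 e3 e4 e5; rewrite ?e1 ?e2 ?e3 ?e4 ?e5 {e1 e2 e3 e4 e5}.
case: (cyc _ _ _ bde) => e1 e2 e3 e4 e5; rewrite ?e1 ?e2 ?e3 ?e4 ?e5 {e1 e2 e3 e4 e5}.
case: (cyc _ _ _ cde) => e1 e2 e3 e4 e5; rewrite ?e1 ?e2 ?e3 ?e4 ?e5 {e1 e2 e3 e4 e5}.
clear.
by do 10 case: (ccw _ _ _).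
Qed.

End Orientation.

(** * Polylines and their chords *)

Section Polyline.
Variables (R : realFieldType) (pos : nat -> R * R) (D : pred nat).
Hypothesis generic : forall i j k, D i -> D j -> D k ->
  i != j -> i != k -> j != k -> generic3 (pos i) (pos j) (pos k).

Definition cross i j k l := crossing (pos i) (pos j) (pos k) (pos l).

Lemma generic5_uniq a b c d e : all D [:: a; b; c; d; e] ->
  uniq [:: a; b; c; d; e] ->
  generic5 (pos a) (pos b) (pos c) (pos d) (pos e).
Proof.
rewrite /= !inE !negb_or => /and5P[? ? ? ? /andP[? _]].
move=> /and5P[/and4P[? ? ? ?] /and3P[? ? ?] /andP[? ?] ? _].
by split; split; apply: generic.
Qed.

Lemma crossC i j k l : cross i j k l = cross k l i j.
Proof. exact: crossingC. Qed.

Lemma crossS i j k l : all D [:: i; j; k; l] -> uniq [:: i; j; k; l] ->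
  cross i j l k = cross i j k l.
Proof.
rewrite /= !inE !negb_or => /and5P[? ? ? ? _].
move=> /and4P[/and3P[? ? ?] /andP[? ?] ? _].
rewrite /cross /crossing addbC; congr (_ && _).
by rewrite !(@ccw_swap12 _ (pos k) (pos l)) ?addbN ?addNb ?negbK //;
   apply: generic; rewrite // eq_sym.
Qed.

Fixpoint cross_path a b y ys :=
  if ys is z :: ys' then cross a b y z (+) cross_path a b z ys' else false.

Fixpoint cross_paths x xs y ys :=
  if xs is z :: xs' then cross_path x z y ys (+) cross_paths z xs' y ys
  else false.

(* Cutting a polygon into the triangles of a fan with apex [c] shows that, up to the
   parity of the triangles containing the ends, a polyline crosses a segment as often
   as its chord does. *)
Fixpoint fan c y ys a :=
  if ys is z :: ys' then
    in_triangle (pos a) (pos c) (pos y) (pos z) (+) fan c z ys' a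
  else false.

(** By induction the pieces [c y] and [y z] are replaced by the chord [c z]; the first part of
    [five_points], for the triangle [c y z], gives the correction. *)
Lemma cross_path_fan a b c y ys :
  all D [:: a, b, c, y & ys] -> uniq [:: a, b, c, y & ys] ->
  cross_path a b c (y :: ys) =
    cross a b c (last y ys) (+) (fan c y ys a (+) fan c y ys b).
Proof.
elim: ys y => [|z ys IH] y //=.
move=> /and5P[Da Db Dc Dy /andP[Dz Dys]]; rewrite !inE !negb_or.
move=> /and5P[/and5P[ab ac ay az ays] /and4P[bc bY bz bys]
  /and3P[cy cz cys] /andP[yz yys] /andP[zys uys]].
have /= := IH z; rewrite Da Db Dc Dz Dys !inE !negb_or.
rewrite ab ac az ays bc bz bys cz cys zys uys => /(_ isT isT).
have Dall : all D [:: a; b; c; y; z] by rewrite /= Da Db Dc Dy Dz.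
have Uall : uniq [:: a; b; c; y; z].
  by rewrite /= !inE !negb_or ab ac ay az bc bY bz cy cz yz.
have [+ _] := five_points (generic5_uniq Dall Uall).
rewrite -!/(cross _ _ _ _) (@crossS a b c z); last first.
- by rewrite /= !inE !negb_or ab ac az bc bz cz.
- by rewrite /= Da Db Dc Dz.
move: (cross a b c y) (cross a b y z) (cross a b c z) (cross_path _ _ _ _)
  (cross _ _ _ (last _ _)) (fan c z ys a) (fan c z ys b)
  (in_triangle _ _ _ _) (in_triangle _ _ _ _).
by do 9 case.
Qed.

(** The second polyline is straightened against each piece of the first, where the fan terms
    telescope, and then the first against the chord of the second. Every correction depends on one
    polyline and one end of the other, which is the shape of [potential_cross]. *)
Lemma cross_pathsE x x1 xs y y1 ys :
  all D ([:: x, x1 & xs] ++ [:: y, y1 & ys]) ->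
  uniq ([:: x, x1 & xs] ++ [:: y, y1 & ys]) ->
  cross_paths x (x1 :: xs) y (y1 :: ys) =
    cross x (last x1 xs) y (last y1 ys)
    (+) ((fan x x1 xs y (+) fan x x1 xs (last y1 ys))
    (+)  (fan y y1 ys x (+) fan y y1 ys (last x1 xs))).
Proof.
move=> DD UU; set t := last y1 ys.
have tys : t \in y1 :: ys by exact: mem_last.
have Dall z : z \in [:: x, x1 & xs] ++ [:: y, y1 & ys] -> D z.
  by move/allP: DD; apply.
have split u us : subseq (u :: us) [:: x, x1 & xs] ->
    cross_paths u us y (y1 :: ys) =
    cross_path y t u us (+) (fan y y1 ys u (+) fan y y1 ys (last u us)).
  elim: us u => [|v us IH] u sub; first by rewrite /= addbb.
  rewrite [LHS]/= [cross_path y t _ _]/= -/(cross_path _ _ _ _).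
  rewrite IH; last by apply: subseq_trans sub; exact: subseq_cons.
  have sub2 : subseq [:: u, v, y, y1 & ys] ([:: x, x1 & xs] ++ [:: y, y1 & ys]).
    rewrite -[[:: u, v, y, y1 & ys]]/([:: u; v] ++ [:: y, y1 & ys]).
    apply: cat_subseq => //; apply: subseq_trans sub.
    by rewrite /= !eqxx sub0seq.
  rewrite -/(cross_path u v y (y1 :: ys)) cross_path_fan -/t.
  - rewrite crossC; move: (cross _ _ _ _) (cross_path _ _ _ _).
    move: (fan _ _ _ _) (fan _ _ _ _) (fan _ _ _ _).
    by do 5 case.
  - by apply/allP => z /(mem_subseq sub2); exact: Dall.
  - exact: subseq_uniq sub2 UU.
rewrite split // cross_path_fan.
- rewrite crossC; move: (cross _ _ _ _) (fan _ _ _ _) (fan _ _ _ _).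
  by move: (fan _ _ _ _) (fan _ _ _ _); do 5 case.
- apply/allP => z; rewrite in_cons => /orP[/eqP->|].
    by apply: Dall; rewrite mem_cat mem_head orbT.
  rewrite in_cons => /orP[/eqP->|zx]; apply: Dall; rewrite mem_cat ?zx //.
  by rewrite (in_cons y) tys !orbT.
- have ytu : uniq [:: y; t].
    move: UU; rewrite cat_uniq => /and3P[_ _] /andP[h _].
    by rewrite /= mem_seq1 andbT; apply: contraNneq h => ->.
  rewrite -[[:: y, t, x, x1 & xs]]/([:: y; t] ++ [:: x, x1 & xs]).
  rewrite uniq_catC; move: UU; rewrite !cat_uniq => /and3P[-> /hasPn h _].
  rewrite ytu andbT; apply/hasPn => z; rewrite !inE => /orP[]/eqP->; apply: h.
    exact: mem_head.
  by rewrite inE tys orbT.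
Qed.

End Polyline.

(** In the ring structure of [bool], parity identities come within reach of [ring]. *)
Lemma addb_add (a b : bool) : a (+) b = a + b. Proof. by []. Qed.

(** * Parity obstructions for K5 and K33 *)

Section NonPlanar.
Variables (R : realFieldType) (pos : nat -> R * R) (D : pred nat).
Hypothesis generic : forall i j k, D i -> D j -> D k ->
  i != j -> i != k -> j != k -> generic3 (pos i) (pos j) (pos k).
Hypothesis D6 : all D (iota 0 6).
Variable W : nat -> nat -> nat -> bool.

(** The right-hand side is the coboundary of [W] modulo 2. [W i j k] can be read as the edge [i j]
    being moved across the node [k], which changes its crossings with all edges at [k]. *)
Definition potential_cross i j k l :=
  cross pos i j k l = (W i j k (+) W i j l) (+) (W k l i (+) W k l j).

(** Each [W i j k] enters the crossings of [i j] with the two edges from [k] to the other nodes, so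
    the sum of all fifteen crossings is even; by [five_points] it is odd. *)
Lemma K5_parity :
  (forall i j k l, (i < j < 5)%N -> (k < l < 5)%N -> uniq [:: i; j; k; l] ->
     potential_cross i j k l) -> False.
Proof.
move=> H.
have D5 : all D [:: 0; 1; 2; 3; 4]%N.
  by move: D6 => /= /and5P[-> -> -> -> /andP[-> _]].
have [_] := five_points (generic5_uniq generic D5 isT).
rewrite -!/(cross pos _ _ _ _) !H // !addb_add.
set S := (X in is_true X).
pose T : bool := W 0 1 2 + W 0 1 3 + W 0 1 4 + W 0 2 1 + W 0 2 3 + W 0 2 4 + W 0 3 1 +
    W 0 3 2 + W 0 3 4 + W 0 4 1 + W 0 4 2 + W 0 4 3 + W 1 2 0 + W 1 2 3 +
    W 1 2 4 + W 1 3 0 + W 1 3 2 + W 1 3 4 + W 1 4 0 + W 1 4 2 + W 1 4 3 +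
    W 2 3 0 + W 2 3 1 + W 2 3 4 + W 2 4 0 + W 2 4 1 + W 2 4 3 + W 3 4 0 +
    W 3 4 1 + W 3 4 2.
have -> : S = T + T by rewrite /S /T; ring.
by rewrite -addb_add addbb.
Qed.

(* Summing the parity of the three K5's spanned by one side of K33 and two
   vertices of the other leaves the crossings of K33, since two closed
   triangles cross evenly. *)
Lemma K33_parity :
  (forall i j k l, (i < 3 <= j)%N -> (j < 6)%N -> (k < 3 <= l)%N -> (l < 6)%N ->
     uniq [:: i; j; k; l] -> potential_cross i j k l) -> False.
Proof.
move=> H.
have D6' i : (i < 6)%N -> D i by move=> i6; apply: (allP D6); rewrite mem_iota.
have tri i j : (i < j < 3)%N ->
    cross pos i j 3 4 + cross pos i j 4 5 + cross pos i j 3 5 =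
    in_triangle (pos i) (pos 3) (pos 4) (pos 5)
    + in_triangle (pos j) (pos 3) (pos 4) (pos 5).
  move=> ij.
  have Dij : all D [:: i; j; 3; 4; 5]%N by rewrite /= !D6' //; lia.
  have Uij : uniq [:: i; j; 3; 4; 5]%N by rewrite /= !inE; lia.
  have [+ _] := five_points (generic5_uniq generic Dij Uij).
  rewrite -!/(cross pos _ _ _ _) (@crossS _ _ _ generic i j 3 5)%N //.
    by rewrite /= !D6' //; lia.
  by rewrite /= !inE; lia.
have D5 i j : (i < j)%N -> (j < 6)%N -> all D [:: 0; 1; 2; i; j]%N.
  by move=> ij j6; rewrite /= !D6' //; lia.
have [_ h1] := five_points (generic5_uniq generic (D5 3 4 isT isT)%N isT).
have [_ h2] := five_points (generic5_uniq generic (D5 3 5 isT isT)%N isT).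
have [_ h3] := five_points (generic5_uniq generic (D5 4 5 isT isT)%N isT).
move: h1 h2 h3; rewrite -!/(cross pos _ _ _ _).
set S1 := (X in is_true X -> _); set S2 := (X in _ -> is_true X -> _).
set S3 := (X in _ -> _ -> is_true X -> _) => h1 h2 h3.
have : S1 (+) S2 (+) S3 by rewrite h1 h2 h3.
(* [T] collects what occurs twice: every [W], and the crossings within [0, 1, 2, k], a quadruple
   that lies in two of the three K5's. *)
pose T : bool := W 0 3 1 + W 0 3 2 + W 0 3 4 + W 0 3 5 + W 0 4 1 + W 0 4 2 + W 0 4 3 +
    W 0 4 5 + W 0 5 1 + W 0 5 2 + W 0 5 3 + W 0 5 4 + W 1 3 0 + W 1 3 2 +
    W 1 3 4 + W 1 3 5 + W 1 4 0 + W 1 4 2 + W 1 4 3 + W 1 4 5 + W 1 5 0 +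
    W 1 5 2 + W 1 5 3 + W 1 5 4 + W 2 3 0 + W 2 3 1 + W 2 3 4 + W 2 3 5 +
    W 2 4 0 + W 2 4 1 + W 2 4 3 + W 2 4 5 + W 2 5 0 + W 2 5 1 + W 2 5 3 +
    W 2 5 4 + cross pos 0 1 2 3 + cross pos 0 2 1 3 + cross pos 0 1 2 4 +
    cross pos 0 2 1 4 + cross pos 0 1 2 5 + cross pos 0 2 1 5 + cross pos
    0 3 1 2 + cross pos 0 4 1 2 + cross pos 0 5 1 2.
have -> : S1 (+) S2 (+) S3 = T + T
    + ((cross pos 0 1 3 4 + cross pos 0 1 4 5 + cross pos 0 1 3 5)
     + (cross pos 0 2 3 4 + cross pos 0 2 4 5 + cross pos 0 2 3 5)
     + (cross pos 1 2 3 4 + cross pos 1 2 4 5 + cross pos 1 2 3 5)).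
  rewrite /S1 /S2 /S3 /T
    (H 0 3 1 4)%N // (H 0 3 1 5)%N // (H 0 4 1 3)%N // (H 0 4 1 5)%N // (H 0 5 1 3)%N // (H 0 5 1 4)%N //
    (H 0 3 2 4)%N // (H 0 3 2 5)%N // (H 0 4 2 3)%N // (H 0 4 2 5)%N // (H 0 5 2 3)%N // (H 0 5 2 4)%N //
    (H 1 3 2 4)%N // (H 1 3 2 5)%N // (H 1 4 2 3)%N // (H 1 4 2 5)%N // (H 1 5 2 3)%N // (H 1 5 2 4)%N //.
  by rewrite !addb_add; ring.
rewrite !tri // -!addb_add addbb.
by do 3 case: (in_triangle _ _ _ _).
Qed.

End NonPlanar.

(** * Perturbation into general position *)

Section Perturbation.
Variable R : realFieldType.

Lemma nonroot_near0 (q : {poly R}) (d : R) : q != 0 -> 0 < d ->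
  exists2 t, 0 < t < d & q.[t] != 0.
Proof.
move=> q0 d0; pose f n := d / n.+2%:R.
have fP n : 0 < f n < d.
  rewrite divr_gt0 ?ltr0n //= ltr_pdivrMr ?ltr0n // ltr_pMr //.
  by rewrite ltr1n.
have finj : injective f.
  move=> m n /(mulfI (lt0r_neq0 d0))/invr_inj/eqP; rewrite eqr_nat.
  by move=> /eqP[].
pose s := map f (iota 0 (size q)).
case: (boolP (all (root q) s)) => [rs|/allPn[_ /mapP[n _ ->] h]]; last first.
  by exists (f n).
have := max_poly_roots q0 rs; rewrite map_inj_uniq ?iota_uniq //.
by rewrite size_map size_iota ltnn => /(_ isT).
Qed.

Variable P : nat -> R * R.

Definition moment_shift t n : R * R := ((P n).1 + t * n%:R, (P n).2 + t * n%:R ^+ 2).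

(* Displacing the points along the moment curve makes every area a quadratic
   polynomial in [t] whose leading coefficient is a Vandermonde determinant. *)
Lemma generic_shift (N : nat) (d : R) : 0 < d ->
  exists2 t, 0 < t < d & forall i j k, (i < N)%N -> (j < N)%N -> (k < N)%N ->
    i != j -> i != k -> j != k ->
    generic3 (moment_shift t i) (moment_shift t j) (moment_shift t k).
Proof.
move=> d0.
pose X n : {poly R} := (P n).1%:P + 'X * n%:R%:P.
pose Y n : {poly R} := (P n).2%:P + 'X * (n%:R ^+ 2)%:P.
pose q i j k := (X j - X i) * (Y k - Y i) - (Y j - Y i) * (X k - X i).
have qE i j k t : (q i j k).[t] = area (moment_shift t i) (moment_shift t j) (moment_shift t k).
  by rewrite /q /X /Y /area !hornerE /=; ring.
have q0 i j k : i != j -> i != k -> j != k -> q i j k != 0.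
  move=> ij ik jk; apply/eqP => q0.
  (* The second difference at 0 isolates twice the leading coefficient of the quadratic. *)
  have : 2 * ((j%:R - i%:R) * (k%:R - i%:R) * (k%:R - j%:R)) =
         (q i j k).[1] + (q i j k).[-1] - 2 * (q i j k).[0] :> R.
    by rewrite !qE /area /=; ring.
  rewrite q0 !horner0 mulr0 subr0 addr0 => /eqP.
  by rewrite !mulf_eq0 !subr_eq0 !eqr_nat pnatr_eq0 /= ![_ == i]eq_sym
    (negPf ij) (negPf ik) (eq_sym k) (negPf jk).
pose Q := \prod_(i < N) \prod_(j < N) \prod_(k < N |
  [&& i != j, i != k & j != k]) q i j k.
have Q0 : Q != 0.
  apply/prodf_neq0 => i _; apply/prodf_neq0 => j _; apply/prodf_neq0 => k.
  by move=> /and3P[ij ik jk]; exact: q0.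
have [t td Qt] := nonroot_near0 Q0 d0; exists t => // i j k iN jN kN ij ik jk.
rewrite /generic3 -qE; apply: contraNneq Qt => qt.
pose i' := Ordinal iN; pose j' := Ordinal jN; pose k' := Ordinal kN.
rewrite /Q (bigD1 i') //= (bigD1 j') //= (bigD1 k') /=; last first.
  by rewrite -!val_eqE /= ij ik jk.
by rewrite !hornerM qt !mul0r.
Qed.

End Perturbation.

From mathcomp Require Import all_classical all_reals all_analysis.

Import Order.TTheory GRing.Theory Num.Theory numFieldNormedType.Exports.
Local Open Scope classical_set_scope.
Local Open Scope ring_scope.

(** * Plane topology *)

Section Chains.
Variable R : realType.
Implicit Types (S : set (R * R)) (x y : R * R).

Definition step S (e : R) : rel (R * R) :=
  fun u v => [&& `[< S u >], `[< S v >] & `|u - v| < e].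

Lemma stepP S (e : R) x y :
  reflect [/\ S x, S y & `|x - y| < e] (step S e x y).
Proof. by apply: (iffP and3P) => -[/asboolP Sx /asboolP Sy xy]; split. Qed.

(** The points of [S] reached by chains of steps shorter than [e] form a nonempty subset that is
    both open and closed in [S]. *)
Lemma connected_chain S x y (e : R) : connected S -> S x -> S y -> 0 < e ->
  exists s, path (step S e) x (rcons s y).
Proof.
move=> cS Sx Sy e0.
pose B := [set z | S z /\ exists s, path (step S e) x (rcons s z)].
have stepB z w : B z -> S w -> `|z - w| < e -> B w.
  move=> [Sz [s xs]] Sw zw; split=> //; exists (rcons s z).
  by rewrite rcons_path xs last_rcons; apply/stepP.
suff BS : B = S by have [] : B y by rewrite BS.
have Bx : B x.
  split=> //; exists [::]; rewrite /= andbT; apply/stepP.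
  by rewrite subrr normr0.
apply: cS.
- by exists x.
- exists (\bigcup_(z in B) ball z e).
    by apply: bigcup_open => z _; exact: ball_open.
  apply/seteqP; split=> [z Bz|z [Sz [w Bw]]].
    by split; [case: Bz|exists z => //; exact: ballxx].
  by rewrite -ball_normE /= => wz; exact: stepB wz.
- exists (~` \bigcup_(z in S `\` B) ball z e).
    by apply: open_closedC; apply: bigcup_open => z _; exact: ball_open.
  apply/seteqP; split=> [z Bz|z [Sz nz]].
    split; first by case: Bz.
    move=> [w [Sw nBw]]; rewrite -ball_normE /= => wz; apply: nBw.
    by apply: stepB Bz Sw _; rewrite distrC.
  by apply: contrapT => nBz; apply: nz; exists z => //; exact: ballxx.
Qed.

Lemma norm2_lt (z : R * R) (e : R) : (`|z| < e) = (`|z.1| < e) && (`|z.2| < e).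
Proof. by rewrite /Num.Def.normr /= gt_max. Qed.

End Chains.

Lemma cross_paths0 (R : realFieldType) (pos : nat -> R * R) (e e' : rel nat)
    x xs y ys :
  path e x xs -> path e' y ys ->
  (forall u v u' v', e u v -> e' u' v' -> ~~ cross pos u v u' v') ->
  cross_paths pos x xs y ys = false.
Proof.
move=> + py H; elim: xs x => [|z xs IH] x //= /andP[xz /IH ->]; rewrite addbF.
elim: ys y py {IH} => [|w ys IHy] y //= /andP[yw /IHy ->]; rewrite addbF.
exact/negbTE/H.
Qed.

(** * From separated connected sets to polylines *)

Lemma base6_inj t u i j k l : (i < 6)%N -> (j < 6)%N -> (k < 6)%N -> (l < 6)%N ->
  (6 + 36 * t + 6 * i + j = 6 + 36 * u + 6 * k + l)%N -> i = k /\ j = l.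
Proof. by lia. Qed.

Section Nodes.
Variables (R : realType) (p : nat -> R * R) (S : nat -> nat -> set (R * R)).
Variables (E : rel nat) (d : R).
Hypothesis E6 : forall i j, E i j -> [&& (i < 6)%N, (j < 6)%N & i != j].
Hypothesis S_conn : forall i j, E i j -> connected (S i j).
Hypothesis S_left : forall i j, E i j -> S i j (p i).
Hypothesis S_right : forall i j, E i j -> S i j (p j).
Hypothesis d_gt0 : 0 < d.
Hypothesis S_sep : forall i j k l, E i j -> E k l -> uniq [:: i; j; k; l] ->
  forall x y, S i j x -> S k l y -> d <= `|x - y|.

(** In each coordinate, a piece of a chain spans less than [e] and its ends move by at most [e], so
    it spans less than [3 e] afterwards. Two pieces that cross after the shift come from points at
    most [e + 3 e + 3 e + e = 8 e] apart, which is less than [d]. *)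
Let e := d / 10.

Let e_gt0 : 0 < e. Proof. by rewrite divr_gt0. Qed.

Let chain_ex i j : exists s, E i j -> path (step (S i j) e) (p i) (rcons s (p j)).
Proof.
have [ij|_] := boolP (E i j); last by exists [::].
have [s sP] := connected_chain (S_conn ij) (S_left ij) (S_right ij) e_gt0.
by exists s.
Qed.

Let m i j := projT1 (cid (chain_ex i j)).

Let mP i j : E i j -> path (step (S i j) e) (p i) (rcons (m i j) (p j)).
Proof. exact: (projT2 (cid (chain_ex i j))). Qed.

(* The nodes are numbered below 6; [idx i j t] numbers vertex [t] of the polyline
   joining the nodes [i] and [j]. *)
Let idx i j t := (6 + 36 * t + 6 * i + j)%N.

Let idx_large v i j t : (v < 6)%N -> v <> idx i j t.
Proof. by rewrite /idx; clear; lia. Qed.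

(** Decodes the numbering by divisions by 36 and 6. Inner vertices of different polylines have
    different numbers even if they coincide as points, and the shift along the moment curve then
    separates them. *)
Let P n : R * R :=
  if (n < 6)%N then p n else
  nth 0 (m ((n - 6) %% 36 %/ 6) ((n - 6) %% 6)) ((n - 6) %/ 36).

Let P_idx i j t : (i < 6)%N -> (j < 6)%N -> P (idx i j t) = nth 0 (m i j) t.
Proof.
move=> i6 j6; rewrite /P.
have -> : (idx i j t < 6)%N = false by rewrite /idx; lia.
rewrite /idx.
have -> : (6 + 36 * t + 6 * i + j - 6 = t * 36 + (i * 6 + j))%N by lia.
have ij36 : (i * 6 + j < 36)%N by lia.
rewrite modnMDl divnMDl // (modn_small ij36) (divn_small ij36) addn0.
rewrite divnMDl // (divn_small j6) addn0.
have -> : (t * 36 + (i * 6 + j) = (t * 6 + i) * 6 + j)%N by lia.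
by rewrite modnMDl modn_small.
Qed.

Let poly i j := rcons [seq idx i j t | t <- iota 0 (size (m i j))] j.

Let map_poly i j : (i < 6)%N -> (j < 6)%N -> map P (poly i j) = rcons (m i j) (p j).
Proof.
move=> i6 j6; rewrite map_rcons {2}/P j6 -map_comp; congr rcons.
rewrite (eq_map (g := nth 0 (m i j))); last by move=> t /=; rewrite P_idx.
exact: mkseq_nth.
Qed.

Let N := (\max_(i < 6) \max_(j < 6) (6 + 36 * size (m i j) + 36)).+1.

Let idx_lt i j t : (i < 6)%N -> (j < 6)%N -> (t < size (m i j))%N -> (idx i j t < N)%N.
Proof.
move=> i6 j6 tm; rewrite /N ltnS.
apply: leq_trans (leq_bigmax (Ordinal i6)).
by apply: leq_trans (leq_bigmax (Ordinal j6)) => /=; rewrite /idx; lia.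
Qed.

Let N6 i : (i < 6)%N -> (i < N)%N.
Proof.
move=> i6; rewrite /N ltnS.
apply: leq_trans (leq_bigmax (Ordinal i6)).
by apply: leq_trans (leq_bigmax (Ordinal i6)) => /=; lia.
Qed.

Let mem_poly i j z : z \in i :: poly i j ->
  [\/ z = i, z = j | exists2 t, (t < size (m i j))%N & z = idx i j t].
Proof.
rewrite in_cons mem_rcons in_cons => /or3P[/eqP->|/eqP->|/mapP[t tm ->]].
- by constructor 1.
- by constructor 2.
- by constructor 3; exists t => //; move: tm; rewrite mem_iota.
Qed.

Let poly_lt i j : (i < 6)%N -> (j < 6)%N -> all (fun n => n < N)%N (i :: poly i j).
Proof.
move=> i6 j6; apply/allP => z /mem_poly[->|->|[t tm ->]].
- exact: N6.
- exact: N6.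
- exact: idx_lt.
Qed.

Let poly_uniq i j : (i < 6)%N -> (j < 6)%N -> i != j -> uniq (i :: poly i j).
Proof.
move=> i6 j6 ij; rewrite cons_uniq rcons_uniq mem_rcons in_cons negb_or ij.
rewrite map_inj_uniq ?iota_uniq ?andbT; last first.
  by move=> t t'; rewrite /idx; lia.
by apply/andP; split; apply/negP => /mapP[t _]; rewrite /idx; lia.
Qed.

(** The polylines of disjoint edges do not cross, so [cross_pathsE] expresses the crossing of their
    chords by the fan terms, which are taken as [W]. *)
Lemma polyline_potential : exists (pos : nat -> R * R) W,
  (forall i j k, (i < 6)%N -> (j < 6)%N -> (k < 6)%N ->
     i != j -> i != k -> j != k -> generic3 (pos i) (pos j) (pos k)) /\
  (forall i j k l, E i j -> E k l -> uniq [:: i; j; k; l] ->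
     potential_cross pos W i j k l).
Proof.
have N0 : 0 < N%:R :> R by rewrite ltr0n.
(* The coordinates of point [n] move by [t n] and [t n ^ 2], both at most [t N ^ 2 < e]. *)
have eN : 0 < e / N%:R ^+ 2 by rewrite divr_gt0 // exprn_gt0.
have [t /andP[t0 tN] gen] := generic_shift P N eN.
pose pos := moment_shift P t.
have near n : (n < N)%N -> `|(pos n).1 - (P n).1| <= e /\ `|(pos n).2 - (P n).2| <= e.
  move=> nN.
  move: tN; rewrite ltr_pdivlMr ?exprn_gt0 // => tN.
  rewrite /pos /moment_shift /=.
  split; rewrite addrAC subrr add0r ger0_norm ?mulr_ge0 ?exprn_ge0 ?(ltW t0) //;
    apply: le_trans (ltW tN); rewrite ler_pM2l // -?natrX ler_nat.
    by rewrite (leq_trans (ltnW nN)) // -[X in (X <= _)%N]expn1 leq_pexp2l.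
  by rewrite leq_exp2r // ltnW.
pose W i j k := fan pos i (head 0%N (poly i j)) (behead (poly i j)) k.
exists pos, W; split=> [i j k i6 j6 k6|i j k l ij kl Uijkl].
  by apply: gen; exact: N6.
have /and3P[i6 j6 iDj] := E6 ij; have /and3P[k6 l6 kDl] := E6 kl.
have polyE a b : poly a b = head 0%N (poly a b) :: behead (poly a b).
  by rewrite /poly; case: (map _ _).
have lastE a b : last (head 0%N (poly a b)) (behead (poly a b)) = b.
  by rewrite -[LHS]/(last 0%N (_ :: _)) -polyE last_rcons.
have DD : all (fun n => n < N)%N ((i :: poly i j) ++ (k :: poly k l)).
  by rewrite all_cat !poly_lt.
have UU : uniq ((i :: poly i j) ++ (k :: poly k l)).
  rewrite cat_uniq !poly_uniq // andbT; apply/hasPn => z zkl; apply/negP => zij.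
  move: Uijkl; rewrite /= !inE !negb_or => /and3P[/and3P[_ ik il] /andP[jk jl] _].
  case: (mem_poly zkl) => [zk|zl|[u _ zu]]; case: (mem_poly zij) => [zi|zj|[v _ zv]].
  - by rewrite -zi zk eqxx in ik.
  - by rewrite -zj zk eqxx in jk.
  - by apply: (idx_large k6); rewrite -zk zv.
  - by rewrite -zi zl eqxx in il.
  - by rewrite -zj zl eqxx in jl.
  - by apply: (idx_large l6); rewrite -zl zv.
  - by apply: (idx_large i6); rewrite -zi zu.
  - by apply: (idx_large j6); rewrite -zj zu.
  - have [eik _] := base6_inj i6 j6 k6 l6 (etrans (esym zv) zu).
    by rewrite eik eqxx in ik.
have gen' a b c : (a < N)%N -> (b < N)%N -> (c < N)%N ->
  a != b -> a != c -> b != c -> generic3 (pos a) (pos b) (pos c) by exact: gen.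
have := @cross_pathsE R pos (fun n => n < N)%N gen' i
  (head 0%N (poly i j)) (behead (poly i j)) k (head 0%N (poly k l)) (behead (poly k l)).
rewrite -!polyE => /(_ DD UU); rewrite !lastE.
have stepsP a b : E a b -> path (fun u v => [&& u < N, v < N &
    step (S a b) e (P u) (P v)])%N a (poly a b).
  move=> ab; have /and3P[a6 b6 _] := E6 ab.
  have : path (relpre P (step (S a b) e)) a (poly a b).
    by rewrite -path_map map_poly // {1}/P a6 mP.
  have := poly_lt a6 b6; move: (step (S a b) e) (poly a b) => r s.
  elim: s a {ab a6} => [|u s IH] a //= /and3P[aN uN sN] /andP[au us].
  by rewrite aN uN au IH //= uN.
rewrite (cross_paths0 (stepsP _ _ ij) (stepsP _ _ kl)); last first.
  move=> u v u' v' /and3P[uN vN /stepP[Su Sv uv]] /and3P[uN' vN' /stepP[Su' Sv' uv']].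
  apply/negP => /crossing_meet[[a b] /= /andP[/andP[a0 a1] /andP[b0 b1]] [z1 z2]].
  have := S_sep ij kl Uijkl Su Su'; apply/negP; rewrite -ltNge.
  have de : d = 10 * e by rewrite /e; field.
  have coord (x y x' y' X Y X' Y' : R) :
      `|x - X| <= e -> `|y - Y| <= e -> `|x' - X'| <= e -> `|y' - Y'| <= e ->
      `|X - Y| < e -> `|X' - Y'| < e ->
      x + a * (y - x) = x' + b * (y' - x') -> `|X - X'| < d.
    rewrite !ler_norml !ltr_norml => /andP[? ?] /andP[? ?] /andP[? ?] /andP[? ?].
    move=> /andP[? ?] /andP[? ?] eq.
    have scale (c w : R) : 0 <= c -> c <= 1 -> - (3 * e) <= w -> w <= 3 * e ->
        - (3 * e) <= c * w /\ c * w <= 3 * e.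
      move=> c0 c1 w1 w2; apply/andP; rewrite -ler_norml normrM ger0_norm //.
      by rewrite (le_trans (ler_piMl (normr_ge0 w) c1)) // ler_norml w1.
    have [? ?] : - (3 * e) <= a * (y - x) /\ a * (y - x) <= 3 * e.
      by apply: scale => //; lra.
    have [? ?] : - (3 * e) <= b * (y' - x') /\ b * (y' - x') <= 3 * e.
      by apply: scale => //; lra.
    by apply/andP; split; lra.
  move: uv uv'; rewrite !norm2_lt /= => /andP[uv1 uv2] /andP[uv1' uv2'].
  have [nu1 nu2] := near _ uN; have [nv1 nv2] := near _ vN.
  have [nu1' nu2'] := near _ uN'; have [nv1' nv2'] := near _ vN'.
  apply/andP; split.
    exact: coord nu1 nv1 nu1' nv1' uv1 uv1' z1.
  exact: coord nu2 nv2 nu2' nv2' uv2 uv2' z2.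
rewrite -!/(W _ _ _) /potential_cross.
move: (cross _ _ _ _ _) (W i j k) (W i j l) (W k l i) (W k l j).
by do 5 case.
Qed.

End Nodes.

Lemma finite_positive_bound (R : realDomainType) (T : finType) (f : T -> R) :
  (forall t, 0 < f t) -> exists2 d, 0 < d & forall t, d <= f t.
Proof.
move=> f0; suff [d d0 dP] : exists2 d, 0 < d & forall t, t \in enum T -> d <= f t.
  by exists d => // t; apply: dP; rewrite mem_enum.
elim: (enum T) => [|t s [d d0 dP]]; first by exists 1.
exists (Num.min (f t) d); first by rewrite lt_min f0.
move=> u; rewrite inE => /orP[/eqP->|us]; rewrite ge_min ?lexx //.
by rewrite (dP _ us) orbT.
Qed.

Section Plane.
Variable R : realType.
Implicit Types (x y z : R * R) (A B F T : set (R * R)).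

Lemma compact_separated A B : compact A -> compact B -> A `&` B = set0 ->
  exists2 d : R, 0 < d & forall x y, A x -> B y -> d <= `|x - y|.
Proof.
move=> cA cB AB0.
have [[[x y] [Ax By]]|AB] := pselect ((A `*` B) !=set0); last first.
  by exists 1 => // x y Ax By; exfalso; apply: AB; exists (x, y).
pose f (z : (R * R) * (R * R)) : R := `|z.1 - z.2|.
have cf : continuous f.
  move=> z; apply: cvg_norm.
  by apply: cvgB; [exact: cvg_fst|exact: cvg_snd].
have [] := @compact_EVT_min _ R f (A `*` B) _ (compact_setX cA cB)
  (continuous_subspaceT cf).
  by exists (x, y).
move=> [a b]; rewrite inE => -[/= Aa Bb] fmin; exists `|a - b|.
  rewrite normr_gt0 subr_eq0; apply/eqP => ab.
  suff : (A `&` B) a by rewrite AB0.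
  by split=> //; rewrite ab.
by move=> u v Au Bv; apply: (fmin (u, v)); rewrite inE.
Qed.

Definition segment x y : set (R * R) :=
  (fun t : R => x + t *: (y - x)) @` `[0, 1].

Lemma segment_conn x y : connected (segment x y).
Proof.
apply: connected_continuous_connected; first exact: segment_connected.
apply: continuous_subspaceT => t.
by apply: cvgD; [exact: cvg_cst|exact: scalel_continuous].
Qed.

Lemma segment_left x y : segment x y x.
Proof. by exists 0; rewrite /= ?in_itv /= ?lexx ?ler01 // scale0r addr0. Qed.

Lemma segment_right x y : segment x y y.
Proof. by exists 1; rewrite /= ?in_itv /= ?lexx ?ler01 // scale1r addrC subrK. Qed.

Lemma segment_near x y z : segment x y z -> `|z - x| <= `|y - x|.
Proof.
move=> [t]; rewrite /= in_itv /= => /andP[t0 t1] <-.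
by rewrite addrAC subrr add0r normrZ ger0_norm // ler_piMl.
Qed.

(** Takes the place of a path in [F]. The uniform margin keeps the connecting set at positive
    distance from the complement of [F], and so from the drawing. *)
Definition joined F x y := exists2 T, [/\ connected T, T x & T y] &
  exists2 d : R, 0 < d & forall z, T z -> ball z d `<=` F.

Lemma joined_sym F x y : joined F x y -> joined F y x.
Proof. by move=> [T [cT Tx Ty] dP]; exists T. Qed.

Lemma joined_trans F y x z : joined F x y -> joined F y z -> joined F x z.
Proof.
move=> [T [cT Tx Ty] [d d0 dP]] [U [cU Uy Uz] [d' d0' dP']].
exists (T `|` U).
  by split; [apply: connectedU => //; exists y|left|right].
exists (Num.min d d'); first by rewrite lt_min d0.
move=> w [Tw|Uw].
  by apply: subset_trans (dP _ Tw); apply: le_ball; rewrite ge_min lexx.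
by apply: subset_trans (dP' _ Uw); apply: le_ball; rewrite ge_min lexx orbT.
Qed.

Lemma ball_joined F x y (r : R) : 0 < r -> ball x (r + r) `<=` F ->
  ball x r y -> joined F x y.
Proof.
move=> r0 BF; rewrite -ball_normE /= distrC => yr.
exists (segment x y).
  split; [exact: segment_conn|exact: segment_left|exact: segment_right].
exists r => // z /segment_near zx w; rewrite -ball_normE /= => zw.
apply: BF; rewrite -ball_normE /= -(subrKA z) (le_lt_trans (ler_normD _ _)) //.
by rewrite ltrD // distrC (le_lt_trans zx).
Qed.

(** The points joined to [x] form an open and closed subset of [F], since the centre of a ball
    inside [F] is joined to every point of the ball of half the radius. *)
Lemma open_connected_joined F x y : open F -> connected F -> F x -> F y ->
  joined F x y.
Proof.
move=> oF cF Fx Fy; pose B := [set z | F z /\ joined F x z].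
have halfball z : F z -> exists2 r : R, 0 < r & ball z (r + r) `<=` F.
  move=> Fz; have /nbhs_ballP[r /= r0 rF] := open_nbhs_nbhs (conj oF Fz).
  by exists (r / 2); [rewrite divr_gt0|rewrite -splitr].
have subF z (r : R) : 0 < r -> ball z (r + r) `<=` F -> ball z r `<=` F.
  by move=> r0 h; apply: subset_trans h; apply: le_ball; rewrite lerDl ltW.
suff BF : B = F by have [] : B y by rewrite BF.
have joined_refl : joined F x x.
  have [r r0 rF] := halfball _ Fx.
  exact: ball_joined r0 rF (ballxx _ r0).
apply: cF.
- by exists x.
- exists B; last by apply/seteqP; split=> [z Bz|z []//]; split=> //; case: Bz.
  rewrite openE => z [Fz xz]; have [r r0 rF] := halfball _ Fz.
  apply/nbhs_ballP; exists r => // w zw; split; first exact: subF rF _ zw.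
  exact: joined_trans xz (ball_joined r0 rF zw).
- exists (closure B); first exact: closed_closure.
  apply/seteqP; split=> [z Bz|z [Fz clz]].
    by split; [case: Bz|exact: subset_closure].
  split=> //; have [r r0 rF] := halfball _ Fz.
  have [w [[Fw xw] zw]] := clz _ (nbhsx_ballx z _ r0).
  exact: joined_trans xw (joined_sym (ball_joined r0 rF zw)).
Qed.

Lemma open_component_open A x : open A -> open (connected_component A x).
Proof.
move=> oA; rewrite openE => z Cz.
have Az := connected_component_sub Cz.
have /nbhs_ballP[r /= r0 rA] := open_nbhs_nbhs (conj oA Az).
apply/nbhs_ballP; exists r => // w zw; apply: connected_component_trans Cz _.
exists (segment z w); last exact: segment_right.
split; [exact: segment_left| |exact: segment_conn].
move=> u /segment_near uz; apply: rA; rewrite -ball_normE /= distrC.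
by apply: le_lt_trans uz _; move: zw; rewrite -ball_normE /= distrC.
Qed.

End Plane.

(** * Drawings *)

Lemma mem_bigsetU (U : Type) (I : finType) (P : pred I) (F : I -> set U) z :
  (\big[setU/set0]_(i | P i) F i) z <-> exists2 i, P i & F i z.
Proof.
split=> [|[i Pi Fi]]; last by rewrite (bigD1 i) //=; left.
by elim/big_ind: _ => [//|A B IA IB [/IA|/IB] //|i Pi Fi]; exists i.
Qed.

Section Drawing.
Variables (R : realType) (G : sgraph).
Variables (pt : G -> R * R) (arc : {set G} -> R -> R * R).
Hypothesis drawn : planar_drawing pt arc.
Implicit Types (X Y A B : {set G}) (u v w : G).

Let pt_inj : injective pt. Proof. by case: drawn. Qed.

Lemma arc_ends A t v : A \in edges G -> t \in `[0, 1] -> arc A t = pt v ->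
  v \in A.
Proof.
move=> AE t01 Atv; have [_ arcs noV _] := drawn.
have [_ _ [u [w [Auw A0 A1]]]] := arcs _ AE.
have [t0|tn0] := eqVneq t 0.
  by move: Atv; rewrite t0 A0 => /pt_inj <-; rewrite Auw !inE eqxx.
have [t1|tn1] := eqVneq t 1.
  by move: Atv; rewrite t1 A1 => /pt_inj <-; rewrite Auw !inE eqxx orbT.
exfalso; apply: (noV A v AE); exists t => //=; move: t01.
by rewrite !in_itv /= !lt_neqAle tn1 eq_sym tn0.
Qed.

(** The open arc of [A] avoids the closed arc of [B], so a common point is an end of [A]; being a
    vertex on [B], it is an end of [B] as well. *)
Lemma arc_inter A B t s : A \in edges G -> B \in edges G -> A <> B ->
  t \in `[0, 1] -> s \in `[0, 1] -> arc A t = arc B s ->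
  exists2 v, v \in A & v \in B.
Proof.
move=> AE BE AB t01 s01 Ats; have [_ arcs _ noX] := drawn.
have [_ _ [u [w [Auw A0 A1]]]] := arcs _ AE.
have [t0|tn0] := eqVneq t 0.
  exists u; first by rewrite Auw !inE eqxx.
  by apply: (arc_ends BE s01); rewrite -Ats t0.
have [t1|tn1] := eqVneq t 1.
  exists w; first by rewrite Auw !inE eqxx orbT.
  by apply: (arc_ends BE s01); rewrite -Ats t1.
have tI : t \in `]0, 1[.
  by move: t01; rewrite !in_itv /= !lt_neqAle tn1 eq_sym tn0.
suff : ((arc A @` `]0, 1[) `&` (arc B @` `[0, 1])) (arc A t) by rewrite noX.
by split; [exists t|exists s].
Qed.

Lemma edge_nonempty A : A \in edges G -> exists v, v \in A.
Proof. by move=> /edgesP[u [v [_ ->]]]; exists u; rewrite !inE eqxx. Qed.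

(** The part of the drawing that belongs to the subgraph induced by [X]. For the union of two
    adjacent branch sets it is connected and plays the role of an edge of the minor. *)
Definition carrier X : set (R * R) :=
  \big[setU/set0]_(v in X) [set pt v] `|`
  \big[setU/set0]_(A in edges G | A \subset X) (arc A @` `[0, 1]).

Lemma carrierP X z : carrier X z <->
  (exists2 v, v \in X & z = pt v) \/
  (exists A t, [/\ A \in edges G, A \subset X, t \in `[0, 1] & z = arc A t]).
Proof.
rewrite /carrier; split.
  move=> [/mem_bigsetU[v vX ->]|/mem_bigsetU[A /andP[AE AX] [t t01 <-]]].
    by left; exists v.
  by right; exists A, t.
move=> [[v vX ->]|[A [t [AE AX t01 ->]]]]; [left|right]; apply/mem_bigsetU.
  by exists v.
by exists A; [rewrite AE|exists t].
Qed.

Lemma carrier_pt X v : v \in X -> carrier X (pt v).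
Proof. by move=> vX; apply/carrierP; left; exists v. Qed.

Lemma carrier_compact X : compact (carrier X).
Proof.
apply: compactU.
  by apply: bigsetU_compact => v _; exact: compact_set1.
apply: bigsetU_compact => A /andP[AE _].
have [_ arcs _ _] := drawn; have [cA _ _] := arcs _ AE.
by apply: continuous_compact => //; exact: segment_compact.
Qed.

Lemma carrier_disjoint X Y : [disjoint X & Y]%B -> carrier X `&` carrier Y = set0.
Proof.
move=> XY; apply/seteqP; split=> // z [].
have nXY v : v \in X -> v \in Y -> False.
  by move=> vX vY; move: (disjointFr XY vX); rewrite vY.
move=> /carrierP[[v vX ->]|[A [t [AE /fintype.subsetP AX t01 ->]]]].
  move=> /carrierP[[w wY /pt_inj vw]|[B [s [BE /fintype.subsetP BY s01 Bs]]]].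
    by apply: (nXY v) => //; rewrite vw.
  by apply: (nXY v) => //; apply/BY/(arc_ends BE s01).
move=> /carrierP[[w wY Aw]|[B [s [BE /fintype.subsetP BY s01 AB]]]].
  by apply: (nXY w) => //; apply/AX/(arc_ends AE t01).
have [v0 v0A] := edge_nonempty AE.
have nAB : A <> B by move=> eAB; apply: (nXY v0); [exact: AX|apply: BY; rewrite -eAB].
have [v vA vB] := arc_inter AE BE nAB t01 s01 AB.
by apply: (nXY v); [exact: AX|exact: BY].
Qed.

Lemma arc_component X A u t : A \in edges G -> A \subset X -> u \in A ->
  t \in `[0, 1] -> connected_component (carrier X) (pt u) (arc A t).
Proof.
move=> AE AX uA t01; have [_ arcs _ _] := drawn.
have [cA _ [v [w [Avw A0 A1]]]] := arcs _ AE.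
exists (arc A @` `[0, 1]); last by exists t.
split.
- move: uA; rewrite Avw !inE -Avw => /orP[]/eqP->.
    by exists 0; rewrite //= in_itv /= lexx ler01.
  by exists 1; rewrite //= in_itv /= lexx ler01.
- by move=> _ [s s01 <-]; apply/carrierP; right; exists A, s.
- by apply: connected_continuous_connected => //; exact: segment_connected.
Qed.

Lemma carrier_connected X : connected_in (@adj G) X -> connected (carrier X).
Proof.
move=> cX.
have [->|[z0 Xz0]] : carrier X = set0 \/ carrier X !=set0.
  by have [/set0P|/negPn/eqP] := boolP (carrier X != set0); [right|left].
  exact: connected0.
have toV z : carrier X z ->
    exists2 v, v \in X & connected_component (carrier X) (pt v) z.
  move=> /carrierP[[v vX ->]|[A [t [AE AX t01 ->]]]].
    by exists v => //; apply: connected_component_refl; exact: carrier_pt.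
  have [v vA] := edge_nonempty AE.
  by exists v; [exact: (fintype.subsetP AX)|exact: arc_component].
have [v0 v0X v0z0] := toV _ Xz0.
suff -> : carrier X = connected_component (carrier X) (pt v0).
  exact: component_connected.
apply/seteqP; split; last exact: connected_component_sub.
move=> z /toV[v vX vz]; apply: connected_component_trans vz.
have /connectP[p + ->] := cX _ _ v0X vX.
elim: p v0 v0X {v0z0} => [|w p IH] u uX /=.
  by move=> _; apply: connected_component_refl; exact: carrier_pt.
move=> /andP[/and3P[uw _ wX] wp].
apply: connected_component_trans (IH _ wX wp).
pose A : {set G} := [set u; w]%SET.
have AE : A \in edges G by apply/edgesP; exists u, w.
have AX : A \subset X.
  by apply/fintype.subsetP => x; rewrite !inE => /orP[]/eqP->.
have [_ arcs _ _] := drawn; have [_ _ [a [b [Aab A0 A1]]]] := arcs _ AE.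
have uA : u \in A by rewrite !inE eqxx.
have : w \in A by rewrite !inE eqxx orbT.
rewrite Aab !inE => /orP[]/eqP->.
  by rewrite -A0; apply: arc_component; rewrite // in_itv /= lexx ler01.
by rewrite -A1; apply: arc_component; rewrite // in_itv /= lexx ler01.
Qed.

Lemma carriers_separated : exists2 d : R, 0 < d & forall X Y, [disjoint X & Y]%B ->
  forall x y, carrier X x -> carrier Y y -> d <= `|x - y|.
Proof.
have sep (XY : {set G} * {set G}) : exists d : R, 0 < d /\
    ([disjoint XY.1 & XY.2]%B ->
     forall x y, carrier XY.1 x -> carrier XY.2 y -> d <= `|x - y|).
  case: XY => X Y /=; have [dXY|_] := boolP [disjoint X & Y]%B; last by exists 1.
  have [d d0 dP] := compact_separated (carrier_compact (X:=X))
    (carrier_compact (X:=Y)) (carrier_disjoint dXY).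
  by exists d.
have [f fP] := choice sep.
have [d d0 dP] := finite_positive_bound (fun XY => (fP XY).1).
exists d => // X Y dXY x y Xx Yy; apply: le_trans (dP (X, Y)) _.
exact: (fP (X, Y)).2.
Qed.

Lemma drawing_carrier : drawing_set pt arc = carrier [set: G]%SET.
Proof.
apply/seteqP; split=> z.
  move=> [[v _ <-]|[A AE [t t01 <-]]]; apply/carrierP; [left|right].
    by exists v.
  by exists A, t; rewrite finset.subsetT.
move=> /carrierP[[v _ ->]|[A [t [AE _ t01 ->]]]]; [left|right].
  by exists v.
by exists A => //; exists t.
Qed.

Variable F : set (R * R).
Hypothesis F_face : face (drawing_set pt arc) F.
Hypothesis F_outer : forall v, closure F (pt v).

(** [S v] runs inside [F], with a margin, to a point within [d / 2] of [pt v], and from there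
    straight to [pt v]. This last segment may cross the drawing, but it stays within [d / 2] of
    [pt v], hence at least [d / 2] away from every carrier avoiding [v]. *)
Lemma apex : exists x0 (S : G -> set (R * R)) (d : R),
  [/\ 0 < d, forall v, [/\ connected (S v), S v x0 & S v (pt v)] &
      forall v X, v \notin X -> forall x y, S v x -> carrier X y -> d <= `|x - y|].
Proof.
have [x0 Dx0 FE] := F_face.
have oD : open (~` drawing_set pt arc).
  apply: closed_openC; rewrite drawing_carrier.
  by apply: compact_closed; [exact: norm_hausdorff|exact: carrier_compact].
have oF : open F by rewrite FE; exact: open_component_open.
have cF : connected F by rewrite FE; exact: component_connected.
have Fx0 : F x0 by rewrite FE; exact: connected_component_refl.
have FD : F `<=` ~` drawing_set pt arc.
  by rewrite FE; exact: connected_component_sub.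
have [d d0 dP] := carriers_separated.
have d20 : 0 < d / 2 by rewrite divr_gt0.
have ex v : exists Se : set (R * R) * R, [/\ connected Se.1, Se.1 x0, Se.1 (pt v),
    0 < Se.2 & forall X, v \notin X -> forall x y, Se.1 x -> carrier X y ->
      Num.min Se.2 (d / 2) <= `|x - y|].
  have [xv [Fxv]] := F_outer (nbhsx_ballx (pt v) _ d20).
  rewrite -ball_normE /= distrC => xv_near.
  have [T [cT Tx0 Txv] [r r0 rP]] := open_connected_joined oF cF Fx0 Fxv.
  exists (T `|` segment (pt v) xv, r); split=> //=.
  - apply: connectedU => //; last exact: segment_conn.
    by exists xv; split=> //; exact: segment_right.
  - by left.
  - by right; exact: segment_left.
  move=> X vX x y [Tx|/segment_near xv'] Xy; rewrite ge_min.
    apply/orP; left; rewrite leNgt; apply/negP => xy.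
    have /FD : F y by apply: (rP _ Tx); rewrite -ball_normE.
    apply; rewrite drawing_carrier; apply/carrierP.
    move/carrierP: Xy => [[w _ ->]|[A [t [AE _ t01 ->]]]].
      by left; exists w.
    by right; exists A, t; rewrite finset.subsetT.
  apply/orP; right.
  have vX' : [disjoint [set v]%SET & X]%B by rewrite disjoints1.
  have vv : carrier [set v]%SET (pt v) by apply: carrier_pt; rewrite inE.
  have := dP _ _ vX' _ _ vv Xy; rewrite -(subrKA x) => /le_trans/(_ (ler_normD _ _)).
  have : `|pt v - x| < d / 2 by rewrite distrC (le_lt_trans xv').
  by move: `|pt v - x| `|x - y| => a b; lra.
have [f fP] := choice ex.
have [r r0 rP] := finite_positive_bound (f := fun v => (f v).2)
  (fun v => let: And5 _ _ _ h _ := fP v in h).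
exists x0, (fun v => (f v).1), (Num.min r (d / 2)); split.
- by rewrite lt_min r0.
- by move=> v; case: (fP v).
move=> v X vX x y Sx Xy; case: (fP v) => _ _ _ _ h.
apply: le_trans (h X vX x y Sx Xy).
by rewrite le_min !ge_min lexx rP orbT.
Qed.

End Drawing.

(** * A minor together with the apex *)

Section Apex.
Variables (R : realType) (G : sgraph).
Hypothesis outer : outerplanar R G.
Variables (a n : nat) (B : nat -> {set G}) (E : rel nat) (v0 : G).
Hypothesis n6 : (n <= 6)%N.
Hypothesis E_lt : forall i j, E i j -> [&& (i < n)%N, (j < n)%N & i != j].
Hypothesis B_conn : forall i, (i < n)%N -> i != a -> connected_in (@adj G) (B i).
Hypothesis B_mem : forall i, (i < n)%N -> i != a -> exists x, x \in B i.
Hypothesis B_touch : forall i j, E i j -> i != a -> j != a ->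
  touch (@adj G) (B i) (B j).
Hypothesis B_disj : forall i j, (i < n)%N -> (j < n)%N -> i != j ->
  i != a -> j != a -> [disjoint B i & B j]%B.

(* The node [a] of the minor is a point of the outer face: near each vertex the
   outer face comes arbitrarily close, so [a] is joined to every branch set. *)
Lemma apex_potential : exists (pos : nat -> R * R) W,
  (forall i j k, (i < 6)%N -> (j < 6)%N -> (k < 6)%N ->
     i != j -> i != k -> j != k -> generic3 (pos i) (pos j) (pos k)) /\
  (forall i j k l, E i j -> E k l -> uniq [:: i; j; k; l] ->
     potential_cross pos W i j k l).
Proof.
have [pt [arc [drawn [F [F_face _] F_outer]]]] := outer.
have [x0 [S [d1 [d1_gt0 SP S_sep]]]] := apex drawn F_face F_outer.
have [d2 d2_gt0 C_sep] := carriers_separated drawn.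
pose m i := odflt v0 [pick x in B i].
have mB i : (i < n)%N -> i != a -> m i \in B i.
  move=> i_n ia; rewrite /m; case: pickP => [x //|no].
  by have [x] := B_mem i_n ia; rewrite no.
pose p i := if i == a then x0 else pt (m i).
(* Disjoint edges of the minor involve disjoint unions of branch sets, whose carriers are separated;
   an edge at the apex is the set [S] of the vertex representing its other node. *)
pose Q i j := if i == a then S (m j) else if j == a then S (m i) else
  carrier pt arc (B i :|: B j)%SET.
apply: (@polyline_potential R p Q E (Num.min d1 d2)).
- by move=> i j /E_lt/and3P[i_n j_n ->]; rewrite !(leq_trans _ n6).
- move=> i j ij; have /and3P[i_n j_n _] := E_lt ij; rewrite /Q.
  case: eqVneq => [_|ia]; first by have [] := SP (m j).
  case: eqVneq => [_|ja]; first by have [] := SP (m i).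
  apply: (carrier_connected drawn); apply: connected_inU; last exact: B_touch.
  + exact: (@adj_sym G).
  + exact: B_conn.
  + exact: B_conn.
- move=> i j ij; have /and3P[i_n j_n iDj] := E_lt ij; rewrite /Q /p.
  case: (eqVneq i a) => [_|ia]; first by have [] := SP (m j).
  case: (eqVneq j a) => [_|ja]; first by have [] := SP (m i).
  by apply: carrier_pt; rewrite inE mB.
- move=> i j ij; have /and3P[i_n j_n iDj] := E_lt ij; rewrite /Q /p.
  case: (eqVneq j a) => [ja|ja]; last first.
    case: eqVneq => [_|ia]; first by have [] := SP (m j).
    by apply: carrier_pt; rewrite inE mB ?orbT.
  by rewrite -ja (negPf iDj); have [] := SP (m i).
- by rewrite lt_min d1_gt0.
move=> i j k l ij kl Uijkl x y.
have /and3P[i_n j_n iDj] := E_lt ij; have /and3P[k_n l_n kDl] := E_lt kl.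
move: Uijkl; rewrite /= !inE !negb_or => /and4P[/and3P[_ ik il] /andP[jk jl] _ _].
have notin z u v : (z < n)%N -> (u < n)%N -> (v < n)%N -> z != a -> u != a ->
    v != a -> z != u -> z != v -> m z \notin (B u :|: B v)%SET.
  move=> zn un vn za ua va zu zv; have mz := mB _ zn za.
  rewrite inE (disjointFr (B_disj zn un zu za ua) mz).
  by rewrite (disjointFr (B_disj zn vn zv za va) mz).
rewrite /Q ge_min; case: (eqVneq i a) => [ia|ia].
  have ka : k != a by rewrite -ia eq_sym.
  have la : l != a by rewrite -ia eq_sym.
  have ja : j != a by rewrite -ia eq_sym.
  rewrite (negPf ka) (negPf la) => Sx Cy; apply/orP; left.
  exact: S_sep (notin _ _ _ j_n k_n l_n ja ka la jk jl) _ _ Sx Cy.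
case: (eqVneq j a) => [ja|ja].
  have ka : k != a by rewrite -ja eq_sym.
  have la : l != a by rewrite -ja eq_sym.
  rewrite (negPf ka) (negPf la) => Sx Cy; apply/orP; left.
  exact: S_sep (notin _ _ _ i_n k_n l_n ia ka la ik il) _ _ Sx Cy.
rewrite distrC; case: (eqVneq k a) => [ka|ka].
  have la : l != a by rewrite -ka eq_sym.
  move=> Cx Sy; apply/orP; left; apply: S_sep Sy Cx.
  by apply: notin; rewrite // eq_sym.
case: (eqVneq l a) => [la|la].
  move=> Cx Sy; apply/orP; left; apply: S_sep Sy Cx.
  by apply: notin; rewrite // eq_sym.
move=> Cx Cy; apply/orP; right; apply: C_sep Cy Cx.
have dis u w z : (u < n)%N -> (w < n)%N -> u != w -> u != a -> w != a ->
    z \in B u -> z \notin B w.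
  by move=> un wn uw ua wa zu; rewrite (disjointFr (B_disj un wn uw ua wa) zu).
rewrite disjoint_subset; apply/fintype.subsetP => z; rewrite !inE negb_or.
by move=> /orP[]zB; apply/andP; split; apply: dis zB; rewrite // eq_sym.
Qed.

End Apex.

(** * Excluded minors of an outerplanar graph *)

Theorem outerplanar_K4 (R : realType) (G : sgraph) : outerplanar R G ->
  ~ K4_minor (@adj G).
Proof.
move=> outer [M MP Mtouch].
have [_ [v0 _] _] := MP 0%N isT.
(* The apex is node 4 and completes K4 to K5. *)
pose E i j := (i < j < 5)%N.
have [||||||pos [W [gen H]]] := @apex_potential R G outer 4 5 M E v0.
- by [].
- by move=> i j; rewrite /E; lia.
- by move=> i i5 i4; have [] := MP i ltac:(lia).
- by move=> i i5 i4; have [] := MP i ltac:(lia).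
- by move=> i j; rewrite /E => ij i4 j4; apply: Mtouch; lia.
- move=> i j i5 j5 ij i4 j4; have [_ _] := MP i ltac:(lia).
  by apply; [lia|].
apply: (@K5_parity R pos (fun i => i < 6)%N gen _ W) => //.
Qed.

Theorem outerplanar_K23 (R : realType) (G : sgraph) : outerplanar R G ->
  ~ K23_minor (@adj G).
Proof.
move=> outer [M MP Mtouch].
have [_ [v0 _] _] := MP 0%N isT.
(* The apex is node 2: with nodes 0 and 1, the side of size two in K23, it forms one side of K33.
   The map [f] skips it in the numbering of the branch sets. *)
pose E i j := (i < 3 <= j)%N && (j < 6)%N.
pose f i := if (i < 2)%N then i else i.-1.
have f5 i : (i < 6)%N -> i != 2 -> (f i < 5)%N by rewrite /f; case: ifP; lia.
have finj i j : i != 2 -> j != 2 -> i != j -> f i != f j.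
  by rewrite /f; case: ifP; case: ifP; lia.
have [||||||pos [W [gen H]]] := @apex_potential R G outer 2 6 (M \o f) E v0.
- by [].
- by move=> i j; rewrite /E; lia.
- by move=> i i6 i2; have [] := MP (f i) (f5 _ i6 i2).
- by move=> i i6 i2; have [] := MP (f i) (f5 _ i6 i2).
- move=> i j; rewrite /E => ij i2 j2; apply: Mtouch; rewrite /f.
    by case: ifP; lia.
  by case: ifP; lia.
- move=> i j i6 j6 ij i2 j2; have [_ _] := MP (f i) (f5 _ i6 i2).
  by apply; [exact: f5|exact: finj].
apply: (@K33_parity R pos (fun i => i < 6)%N gen _ W) => //.
by move=> i j k l ij j6 kl l6; apply: H; rewrite /E ?ij ?kl.
Qed.

Theorem theorem1 (R : realType) (G : sgraph) :
  outerplanar R G -> (@chi_vi G 2 isT <= max_degree G + 3)%N.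
Proof.
move=> outer; rewrite /chi_vi; case: ex_minnP => k _; apply; apply/boolp.asboolP.
have [c [a gca]] : colourable (@adj G) 'I_(max_degree G + 3) [set: G]%SET.
  apply: (@colourable_all _ _ _ (@adj_sym G) (@adj_irr G) (max_degree G)).
  - by rewrite card_ord.
  - by move=> x; rewrite -/(nbhd x); exact: leq_bigmax.
  - exact: outerplanar_K4 outer.
  - exact: outerplanar_K23 outer.
exact: good_vi_colorable gca.
Qed.
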